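(* Each of the following four decision problems is $\Sigma_2^p$-complete with respect to first-order projections: (1) $\text{QSat}_2$; (2) $\text{QUnsat}_2$; (3) $\exists\exists!\text{Sat}$; (4) $\text{2CC}$.
   Context: Conventions: a (relational) vocabulary is a tuple of relation symbols with arities and constant symbols; every vocabulary implicitly also contains the numeric symbols $\le$, BIT, PLUS, TIMES, SUC, $0,1,\max$. A finite $\sigma$-structure has universe $\{0,\dots,n-1\}$ and the numeric symbols get their standard arithmetic interpretations. STRUC$[\sigma]$ is the set of finite $\sigma$-structures; a decision problem is a subset of STRUC$[\sigma]$ closed under isomorphism; MOD$[\Phi]$ is the set of finite models of $\Phi$. A formula is numeric if it only uses numeric symbols. $\Sigma_2^p$ is the class of problems MOD$[\Phi]$ where $\Phi$ is a second-order sentence of the form $\exists \vec R_1\forall \vec R_2\,\varphi$ with $\vec R_1,\vec R_2$ tuples of relation variables and $\varphi$ first order. First-order projections: for vocabularies $\tau$ and $\sigma=\langle R_1^{a_1},\dots,R_r^{a_r},c_1,\dots,c_s\rangle$, a $k$-ary first-order query is a tuple $I=\langle\varphi_0,\varphi_1,\dots,\varphi_r,\psi_1,\dots,\psi_s\rangle$ of first-order $\tau$-formulas ($\varphi_0$ with $k$ free variables, $\varphi_i$ with $ka_i$, $\psi_j$ with $k$). It maps a $\tau$-structure $\mathcal A$ to the $\sigma$-structure $I(\mathcal A)$ with universe $\{\vec b\in|\mathcal A|^k:\mathcal A\models\varphi_0(\vec b)\}$, $R_i$ interpreted as the set of $a_i$-tuples of such elements satisfying $\varphi_i$ in $\mathcal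 A$, and $c_j$ interpreted as the unique element satisfying $\psi_j$. $I$ is a first-order projection (fop) if $\varphi_0$ is numeric and each $\varphi_i,\psi_j$ has the form $\alpha_0\vee(\alpha_1\wedge\lambda_1)\vee\dots\vee(\alpha_\ell\wedge\lambda_\ell)$ where the $\alpha_t$ are numeric and mutually exclusive and the $\lambda_t$ are $\tau$-literals. $A\le_{fop}B$ means there is a fop $I$ with $\mathcal A\in A\iff I(\mathcal A)\in B$ for all $\mathcal A$. $B$ is $\Sigma_2^p$-hard if $A\le_{fop}B$ for all $A\in\Sigma_2^p$, and $\Sigma_2^p$-complete if moreover $B\in\Sigma_2^p$. Problems. $\text{QSat}_2$: instances are structures over $\sigma_{dnf}=\langle E^1,Q^2,M^2\rangle$ encoding a DNF Boolean formula with a designated set of existential variables: elements serve as Boolean variables and as implicant indices, $E(y)$ means variable $y$ is existential, $Q(x,y)$ (resp. $M(x,y)$) means $y$ occurs positively (resp. negatively) in implicant $x$. Question: is there an assignment to the existential variables such that for every assignment to the remaining variables the formula is true? $\text{QUnsat}_2$: instances are structures over $\sigma_{cnf}=\langle E^1,P^2,N^2\rangle$ encoding a CNF formula in the same way ($P$ positive, $N$ negative occurrence of a variable in a clause, $E$ existential variables); question: is there an assignment to the existential variables such that for every assignment to the remaining variables the formula is false? $\exists\exists!\text{Sat}$: instances are $\sigma_{cnf}$-structures as for $\text{QUnsat}_2$; question: is there an assignment to the existential variables for which exactly one assignment to the remaining variables makes the formula true? $\text{2CC}$: instances are simple graphs (structures over $\langle E^2\rangle$ with $E$ symmetric and irreflexive);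 question: is there a 2-coloring of the vertices such that no maximal clique is monochromatic? *)

(* Defs.v *)
From HB Require Import structures.
From mathcomp Require Import all_boot.

Set Implicit Arguments.
Unset Strict Implicit.
Unset Printing Implicit Defensive.

(** * Vocabularies and finite structures *)

Record relfamily := RelFamily { relsym :> finType; arity : relsym -> nat }.

Definition sum_family (F G : relfamily) : relfamily :=
  @RelFamily (F + G)%type
    (fun r => match r with inl r => arity r | inr r => arity r end).

(* Only the proper symbols are listed: the numeric symbols belong to the
   syntax of formulas over every vocabulary. *)
Record vocabulary := Vocabulary { rels : relfamily; consym : finType }.

Definition interp (F : relfamily) (U : Type) : Type :=
  forall r : F, (arity r).-tuple U -> bool.

(* The size is at least 2: otherwise the numeric constant 1, which denotes the
   element 1 of {0, ..., n-1}, would have no value. *)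
Record structure (tau : vocabulary) := Structure {
  usize : nat;
  usize_gt1 : 1 < usize;
  rel_of : interp (rels tau) 'I_usize;
  con_of : consym tau -> 'I_usize }.

Arguments rel_of {tau} A r t : rename.
Arguments con_of {tau} A c : rename.

Definition univ tau (A : structure tau) : finType := 'I_(usize A).

Definition isomorphic tau (A B : structure tau) : Prop :=
  exists f : univ A -> univ B,
    [/\ bijective f,
        forall (r : rels tau) (t : (arity r).-tuple (univ A)),
          rel_of B r (map_tuple f t) = rel_of A r t
      & forall c : consym tau, f (con_of A c) = con_of B c].

(* Isomorphisms respect the proper symbols only; if they had to respect [<=] as
   well, every isomorphism would be an identity and closure would be void. *)
Definition decision_problem tau (B : structure tau -> Prop) : Prop :=
  forall A A' : structure tau, isomorphic A A' -> (B A <-> B A').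

(** * First-order formulas *)

Section Syntax.
Variable tau : vocabulary.

Inductive term (V : Type) : Type :=
  | Var of V
  | Con of consym tau
  | Zero
  | One
  | Max.

Inductive atom (V : Type) : Type :=
  | Rel (r : rels tau) of (arity r).-tuple (term V)
  | Eq of term V & term V
  | Le of term V & term V
  | Bit of term V & term V
  | Plus of term V & term V & term V
  | Times of term V & term V & term V
  | Suc of term V & term V.

(* [formula V] consists of the formulas whose free variables are among [V]; a
   quantifier binds the variable [None] of its body. *)
Inductive formula (V : Type) : Type :=
  | Atom of atom V
  | Not of formula V
  | And of formula V & formula V
  | Or of formula V & formula V
  | Ex of formula (option V)
  | All of formula (option V).

Definition sentence := formula void.

Definition numeric_term (V : Type) (t : term V) : bool :=
  if t is Con _ then false else true.

Definition numeric_atom (V : Type) (a : atom V) : bool :=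
  match a with
  | Rel _ _ => false
  | Eq s t | Le s t | Bit s t | Suc s t => numeric_term s && numeric_term t
  | Plus s t u | Times s t u =>
      [&& numeric_term s, numeric_term t & numeric_term u]
  end.

Fixpoint numeric (V : Type) (phi : formula V) : bool :=
  match phi with
  | Atom a => numeric_atom a
  | Not p => numeric p
  | And p q | Or p q => numeric p && numeric q
  | Ex p | All p => numeric p
  end.

Definition literal (V : Type) (phi : formula V) : bool :=
  match phi with
  | Atom _ | Not (Atom _) => true
  | _ => false
  end.

End Syntax.

Arguments Zero {tau V}.
Arguments One {tau V}.
Arguments Max {tau V}.

Section Semantics.
Variables (tau : vocabulary) (A : structure tau).

Definition zero_of : univ A := Ordinal (ltnW (usize_gt1 A)).
Definition one_of : univ A := Ordinal (usize_gt1 A).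
Definition max_of : univ A := rev_ord zero_of.

Definition teval (V : Type) (e : V -> univ A) (t : term tau V) : univ A :=
  match t with
  | Var x => e x
  | Con c => con_of A c
  | Zero => zero_of
  | One => one_of
  | Max => max_of
  end.

Definition aeval (V : Type) (e : V -> univ A) (a : atom tau V) : bool :=
  match a with
  | Rel r ts => rel_of A r (map_tuple (teval e) ts)
  | Eq s t => teval e s == teval e t
  | Le s t => teval e s <= teval e t
  | Bit s t => odd (teval e s %/ 2 ^ teval e t)
  | Plus s t u => teval e s + teval e t == teval e u :> nat
  | Times s t u => teval e s * teval e t == teval e u :> nat
  | Suc s t => (teval e s).+1 == teval e t :> nat
  end.

Definition scons (V : Type) (x : univ A) (e : V -> univ A) (v : option V) :
    univ A :=
  if v is Some w then e w else x.

Fixpoint eval (V : Type) (e : V -> univ A) (phi : formula tau V) : bool :=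
  match phi with
  | Atom a => aeval e a
  | Not p => ~~ eval e p
  | And p q => eval e p && eval e q
  | Or p q => eval e p || eval e q
  | Ex p => [exists x : univ A, eval (scons x e) p]
  | All p => [forall x : univ A, eval (scons x e) p]
  end.

End Semantics.

Definition models tau (A : structure tau) (phi : sentence tau) : bool :=
  eval (@of_void (univ A)) phi.

(** * The class Sigma_2^p *)

Definition expand_voc (tau : vocabulary) (X : relfamily) : vocabulary :=
  Vocabulary (sum_family (rels tau) X) (consym tau).

Definition expand tau (A : structure tau) (X : relfamily)
    (I : interp X (univ A)) : structure (expand_voc tau X) :=
  @Structure (expand_voc tau X) (usize A) (usize_gt1 A)
    (fun r => match r with inl r => rel_of A r | inr r => I r end)
    (con_of A).

(* Truth of the second-order sentence [exists X1, forall X2, phi], where [X1]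
   and [X2] are finite families of relation variables. *)
Definition so_models tau (A : structure tau) (X1 X2 : relfamily)
    (phi : sentence (expand_voc (expand_voc tau X1) X2)) : Prop :=
  exists I1 : interp X1 (univ A), forall I2 : interp X2 (univ A),
    models (@expand _ (expand I1) X2 I2) phi.

Definition Sigma2p tau (B : structure tau -> Prop) : Prop :=
  decision_problem B /\
  exists (X1 X2 : relfamily)
         (phi : sentence (expand_voc (expand_voc tau X1) X2)),
    forall A : structure tau, B A <-> so_models A phi.

(** * First-order queries and projections *)

Section Queries.
Variables tau sigma : vocabulary.

Definition query_dom k (phi0 : formula tau 'I_k) (A : structure tau) :
    {set k.-tuple (univ A)} :=
  [set b | eval (tnth b) phi0].

(* The variable [(j, i)] of [qrel r] stands for the [i]-th component of the
   [j]-th argument of [r].  The last two fields say that the query defines a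
   structure on every input: at least two elements, and a unique value for each
   constant. *)
Record query := Query {
  qarity : nat;
  qdom : formula tau 'I_qarity;
  qrel : forall r : rels sigma, formula tau ('I_(arity r) * 'I_qarity);
  qcon : consym sigma -> formula tau 'I_qarity;
  qdom_gt1 : forall A : structure tau, 1 < #|query_dom qdom A|;
  qcon_unique : forall (A : structure tau) (c : consym sigma),
    #|[set b in query_dom qdom A | eval (tnth b) (qcon c)]| = 1 }.

(* The defined universe is renamed to {0, ..., m-1} through [enum_val], that
   is, in the lexicographic order of tuples.  The default value of the constants
   is never used, by [qcon_unique]. *)
Definition apply_query (I : query) (A : structure tau) : structure sigma :=
  let D := query_dom (qdom I) A in
  let elt (i : 'I_#|D|) : (qarity I).-tuple (univ A) := enum_val i in
  @Structure sigma #|D| (qdom_gt1 I A)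
    (fun r t =>
       eval (fun v : 'I_(arity r) * 'I_(qarity I) => tnth (elt (tnth t v.1)) v.2)
            (qrel I r))
    (fun c => odflt (Ordinal (ltnW (qdom_gt1 I A)))
                    [pick i | eval (tnth (elt i)) (qcon I c)]).

Definition mutually_exclusive (V : Type) (alphas : seq (formula tau V)) : Prop :=
  forall (A : structure tau) (e : V -> univ A) (i j : 'I_(size alphas)),
    i != j ->
    ~~ (eval e (tnth (in_tuple alphas) i) && eval e (tnth (in_tuple alphas) j)).

(* [a0 \/ (a1 /\ l1) \/ ... \/ (am /\ lm)], where [s] lists the pairs
   [(at, lt)]. *)
Definition guarded_disj (V : Type) (a0 : formula tau V)
    (s : seq (formula tau V * formula tau V)) : formula tau V :=
  foldl (fun acc p => Or acc (And p.1 p.2)) a0 s.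

Definition projective (V : Type) (phi : formula tau V) : Prop :=
  exists (a0 : formula tau V) (s : seq (formula tau V * formula tau V)),
    [/\ phi = guarded_disj a0 s,
        all (@numeric tau V) (a0 :: unzip1 s),
        mutually_exclusive (a0 :: unzip1 s)
      & all (@literal tau V) (unzip2 s)].

Definition is_fop (I : query) : Prop :=
  [/\ numeric (qdom I),
      forall r : rels sigma, projective (qrel I r)
    & forall c : consym sigma, projective (qcon I c)].

Definition fop_reducible
    (A : structure tau -> Prop) (B : structure sigma -> Prop) : Prop :=
  exists2 I : query, is_fop I &
    forall S : structure tau, A S <-> B (apply_query I S).

End Queries.

Definition Sigma2p_hard sigma (B : structure sigma -> Prop) : Prop :=
  forall (tau : vocabulary) (A : structure tau -> Prop),
    Sigma2p A -> fop_reducible A B.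

Definition Sigma2p_complete sigma (B : structure sigma -> Prop) : Prop :=
  Sigma2p B /\ Sigma2p_hard B.

(** * The problems *)

(* [SymE]: existential variables; [SymPos] ([Q], resp. [P]) and [SymNeg] ([M],
   resp. [N]): positive and negative occurrences.  The vocabularies for DNF and
   CNF formulas differ only in the names of the symbols. *)
Variant nf_sym := SymE | SymPos | SymNeg.

Definition nf_sym_code (s : nf_sym) : 'I_3 :=
  match s with SymE => inord 0 | SymPos => inord 1 | SymNeg => inord 2 end.
Definition nf_sym_decode (i : 'I_3) : nf_sym :=
  match val i with 0 => SymE | 1 => SymPos | _ => SymNeg end.
Lemma nf_sym_codeK : cancel nf_sym_code nf_sym_decode.
Proof. by case; rewrite /nf_sym_decode /= inordK. Qed.
HB.instance Definition _ := Finite.copy nf_sym (can_type nf_sym_codeK).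

Definition nf_arity (s : nf_sym) : nat := if s is SymE then 1 else 2.

Definition sigma_dnf : vocabulary := Vocabulary (RelFamily nf_arity) void.
Definition sigma_cnf : vocabulary := Vocabulary (RelFamily nf_arity) void.

Definition nf_exist (A : structure sigma_cnf) (y : univ A) : bool :=
  rel_of A SymE [tuple y].
Definition nf_pos (A : structure sigma_cnf) (x y : univ A) : bool :=
  rel_of A SymPos [tuple x; y].
Definition nf_neg (A : structure sigma_cnf) (x y : univ A) : bool :=
  rel_of A SymNeg [tuple x; y].

(* Every element is both a variable and the index of an implicant (resp. a
   clause).  An assignment to a set [W] of variables is represented by the
   subset of [W] of the variables set to true; assignments to complementary
   sets are combined by union. *)
Definition exist_vars (A : structure sigma_cnf) : {set univ A} :=
  [set y | nf_exist y].
Definition other_vars (A : structure sigma_cnf) : {set univ A} :=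
  ~: exist_vars A.

Definition dnf_true (A : structure sigma_dnf) (T : {set univ A}) : bool :=
  [exists x : univ A, forall y : univ A,
     (nf_pos x y ==> (y \in T)) && (nf_neg x y ==> (y \notin T))].

Definition cnf_true (A : structure sigma_cnf) (T : {set univ A}) : bool :=
  [forall x : univ A, exists y : univ A,
     nf_pos x y && (y \in T) || nf_neg x y && (y \notin T)].

Definition QSat2 (A : structure sigma_dnf) : Prop :=
  exists2 S : {set univ A}, S \subset exist_vars A &
    forall T : {set univ A}, T \subset other_vars A -> dnf_true (S :|: T).

Definition QUnsat2 (A : structure sigma_cnf) : Prop :=
  exists2 S : {set univ A}, S \subset exist_vars A &
    forall T : {set univ A}, T \subset other_vars A -> ~~ cnf_true (S :|: T).

Definition ExistsUniqueSat (A : structure sigma_cnf) : Prop :=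
  exists2 S : {set univ A}, S \subset exist_vars A &
    exists! T : {set univ A}, T \subset other_vars A /\ cnf_true (S :|: T).

Definition sigma_graph : vocabulary :=
  Vocabulary (@RelFamily unit (fun=> 2)) void.

Definition adj (G : structure sigma_graph) (x y : univ G) : bool :=
  rel_of G tt [tuple x; y].

Definition simple_graph (G : structure sigma_graph) : Prop :=
  symmetric (@adj G) /\ irreflexive (@adj G).

Definition clique (G : structure sigma_graph) (K : {set univ G}) : bool :=
  [forall x in K, forall y in K, (x != y) ==> adj x y].

Definition monochromatic (G : structure sigma_graph) (c : univ G -> bool)
    (K : {set univ G}) : Prop :=
  exists b : bool, forall x, x \in K -> c x = b.

(* A structure that is not a simple graph is not in the problem. *)
Definition TwoCC (G : structure sigma_graph) : Prop :=
  simple_graph G /\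
  exists c : univ G -> bool, forall K : {set univ G},
    maxset (@clique G) K -> ~ monochromatic c K.

(* Main.v *)
From HB Require Import structures.
Require Import Defs.
From mathcomp Require Import all_boot.

(* Everything reduces from "exists X1, forall X2, phi", and all reductions go
   through one CNF.  Tseitin's transformation turns the negation of phi into
   clauses over variables z_g(e), for g a subformula and e an assignment of
   first-order variables to elements; for fixed relations X1 and X2 these clauses
   are satisfiable exactly when phi fails.  So phi holds for some X1 and all X2
   iff some values of the X1-variables leave the CNF unsatisfiable, which is
   QUnsat2, and QSat2 up to negating all literals.  The constants of the
   vocabulary are replaced by variables, because an atom X(c, d) would otherwise
   test two literals of the input at once, which a projection cannot do; after
   that, whether a variable occurs in a clause depends on at most one input
   literal.

   For unique satisfiability, a new variable g is added to every clause, together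
   with the clauses "v or not g": setting g gives exactly one solution, and the
   other solutions are those of the CNF.

   For clique coloring, the vertices include literals and clauses, a clause being
   adjacent to the literals that do not occur in it.  Gadgets force the color of
   clauses to be "false", that of universal literals to be "true", and opposite
   existential literals to have opposite colors.  A monochromatic maximal clique
   then picks one true literal per variable, and its maximality says that every
   clause contains one of them. *)

Set Implicit Arguments.
Unset Strict Implicit.
Unset Printing Implicit Defensive.

(** * Quantified satisfiability and clique coloring over an abstract finite type *)

Section AbstractProblems.
Variable V : finType.

Definition sat (P N : rel V) (a : pred V) : bool :=
  [forall x, exists y, P x y && a y || N x y && ~~ a y].

(** Assignments are total: the values of [s] off [E] and of [t] on [E] are ignored, which spares all
    conditions on domains. *)
Definition mix (E s t : pred V) : pred V := fun v => if E v then s v else t v.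

Definition abs_qunsat (E : pred V) (P N : rel V) : Prop :=
  exists s : pred V, forall t : pred V, ~~ sat P N (mix E s t).

(** Uniqueness is demanded off [E] only, since a total [t] is arbitrary on [E]. *)
Definition abs_eusat (E : pred V) (P N : rel V) : Prop :=
  exists s t : pred V, sat P N (mix E s t) /\
    forall t' : pred V, sat P N (mix E s t') -> forall v, ~~ E v -> t' v = t v.

(** Maximality is tested by adding single vertices, so the property is first order in [K]. *)
Definition max_clique (adj : rel V) (K : pred V) : bool :=
  [forall x, if K x then [forall y, K y ==> (x != y) ==> adj x y]
             else [exists y, K y && ~~ adj x y]].

Definition abs_2cc (adj : rel V) : Prop :=
  [/\ symmetric adj, irreflexive adj &
      exists c : pred V, forall K : pred V,
        max_clique adj K -> [exists x, exists y, [&& K x, K y & c x != c y]]].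

End AbstractProblems.

(** * Transport of the problems along bijections *)

Section Transport.
Variables (A : structure sigma_cnf) (V : finType) (h : V -> univ A).
Hypothesis h_bij : bijective h.
Variables (E : pred V) (P N : rel V).
Hypotheses (hE : forall v, nf_exist (h v) = E v)
           (hP : forall u v, nf_pos (h u) (h v) = P u v)
           (hN : forall u v, nf_neg (h u) (h v) = N u v).

Lemma cnf_true_abs (T : {set univ A}) (a : pred V) :
  (forall v, (h v \in T) = a v) -> cnf_true T = sat P N a.
Proof.
case: (h_bij) => g hK gK eT; apply/forallP/forallP => [H v|H x].
  have /existsP[y Hy] := H (h v); apply/existsP; exists (g y).
  by rewrite -hP -hN -eT gK.
have /existsP[y Hy] := H (g x); apply/existsP; exists (h y).
by move: Hy; rewrite -hP -hN -eT gK.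
Qed.

(** By De Morgan, the negation of a DNF is the CNF with the signs exchanged, whence [sat N P]. *)
Lemma dnf_true_abs (T : {set univ A}) (a : pred V) :
  (forall v, (h v \in T) = a v) -> @dnf_true A T = ~~ sat N P a.
Proof.
case: (h_bij) => g hK gK eT; rewrite negb_forall.
apply/existsP/existsP => [[x /forallP H]|[v]].
  exists (g x); rewrite negb_exists; apply/forallP => y.
  have /andP[H1 H2] := H (h y).
  rewrite -hP -hN -eT gK; move: H1 H2.
  by case: (nf_pos _ _); case: (nf_neg _ _); case: (_ \in _).
rewrite negb_exists => /forallP H; exists (h v); apply/forallP => y.
move: (H (g y)); rewrite -hP -hN -eT gK.
by case: (nf_pos _ _); case: (nf_neg _ _); case: (_ \in _).
Qed.

Lemma mix_setU (S T : {set univ A}) :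
  S \subset exist_vars A -> T \subset other_vars A ->
  forall v, (h v \in S :|: T) =
    mix E (fun v => h v \in S) (fun v => h v \in T) v.
Proof.
move=> /subsetP sS /subsetP sT v; rewrite !inE /mix -hE.
case: ifP => Ev.
  case: (boolP (h v \in T)) => [/sT|]; last by rewrite orbF.
  by rewrite !inE Ev.
by case: (boolP (h v \in S)) => [/sS|//]; rewrite !inE Ev.
Qed.

Let ex_set (s : pred V) := [set h v | v in [pred v | E v && s v]].
Let ot_set (s : pred V) := [set h v | v in [pred v | ~~ E v && s v]].

Let ex_sub s : ex_set s \subset exist_vars A.
Proof. by apply/subsetP => _ /imsetP[v /andP[Ev _] ->]; rewrite inE hE. Qed.

Let ot_sub s : ot_set s \subset other_vars A.
Proof. by apply/subsetP => _ /imsetP[v /andP[Ev _] ->]; rewrite !inE hE. Qed.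

Let ex_in s v : (h v \in ex_set s) = E v && s v.
Proof. by rewrite mem_imset ?inE //; apply: bij_inj. Qed.

Let ot_in s v : (h v \in ot_set s) = ~~ E v && s v.
Proof. by rewrite mem_imset ?inE //; apply: bij_inj. Qed.

Let mixE (S T : {set univ A}) (s t : pred V) :
  S \subset exist_vars A -> T \subset other_vars A ->
  (forall v, E v -> (h v \in S) = s v) ->
  (forall v, ~~ E v -> (h v \in T) = t v) ->
  forall v, (h v \in S :|: T) = mix E s t v.
Proof.
move=> sS sT eS eT v; rewrite mix_setU // /mix.
by case: ifP => [/eS|/negbT/eT].
Qed.

Let S_eq s v : E v -> (h v \in ex_set s) = s v.
Proof. by rewrite ex_in => ->. Qed.

Let T_eq t v : ~~ E v -> (h v \in ot_set t) = t v.
Proof. by rewrite ot_in => ->. Qed.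

(** The map [h] will be the identity for membership, an isomorphism for closure, and the enumeration
    of the image of a query for hardness. *)
Lemma QUnsat2_abs : QUnsat2 A <-> abs_qunsat E P N.
Proof.
split=> [[S sS H]|[s H]].
  exists (fun v => h v \in S) => t.
  rewrite -(@cnf_true_abs (S :|: ot_set t)); first exact: H.
  by apply: mixE => // v; apply: T_eq.
exists (ex_set s) => // T sT.
rewrite (@cnf_true_abs _ (mix E s (fun v => h v \in T))); first exact: H.
by apply: mixE => // v; apply: S_eq.
Qed.

Lemma QSat2_abs : @QSat2 A <-> abs_qunsat E N P.
Proof.
split=> [[S sS H]|[s H]].
  exists (fun v => h v \in S) => t.
  rewrite -(@dnf_true_abs (S :|: ot_set t)); first exact: (H _ (ot_sub t)).
  by apply: mixE => // v; apply: T_eq.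
exists (ex_set s); [exact: ex_sub | move=> T sT].
rewrite (@dnf_true_abs _ (mix E s (fun v => h v \in T))); first exact: H.
by apply: mixE => // v; first [exact: S_eq | exact: T_eq].
Qed.

Lemma ExistsUniqueSat_abs : ExistsUniqueSat A <-> abs_eusat E P N.
Proof.
case: (h_bij) => g hK gK; split=> [[S sS [T [[sT HT] uT]]]|[s [t [H1 H2]]]].
  exists (fun v => h v \in S), (fun v => h v \in T); split.
    by rewrite -(@cnf_true_abs (S :|: T)) //; apply: mixE.
  move=> t'; rewrite -(@cnf_true_abs (S :|: ot_set t')) => [Ht' v nEv|].
    by rewrite (uT (ot_set t')) ?T_eq.
  by apply: mixE => // v; apply: T_eq.
exists (ex_set s) => //; exists (ot_set t); split.
  split=> //; rewrite (@cnf_true_abs _ (mix E s t)) //.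
  by apply: mixE => // v; first [exact: S_eq | exact: T_eq].
move=> T' [sT']; rewrite (@cnf_true_abs _ (mix E s (fun v => h v \in T'))).
  move=> /H2 H; apply/setP => x; rewrite -(gK x).
  case: (boolP (E (g x))) => nEx; last by rewrite T_eq // H.
  rewrite ot_in nEx /=; apply/esym/negbTE/negP => /(subsetP sT').
  by rewrite !inE hE nEx.
by apply: mixE => // v; first [exact: S_eq | exact: T_eq].
Qed.

End Transport.

Section GraphTransport.
Variables (G : structure sigma_graph) (V : finType) (h : V -> univ G).
Hypothesis h_bij : bijective h.
Variable e : rel V.
Hypothesis he : forall u v, adj (h u) (h v) = e u v.

(** A vertex [v] outside [K] and adjacent to all of [K] would give the larger clique [h v |: K].
    Conversely, a new vertex of a larger clique is adjacent to all of [K], against the non-neighbor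
    that [max_clique] provides. *)
Lemma maxset_clique_abs (K : {set univ G}) (k : pred V) :
  symmetric e -> (forall v, (h v \in K) = k v) ->
  maxset (@clique G) K <-> max_clique e k.
Proof.
case: (h_bij) => g hK gK e_sym eK.
have adjE x y : adj x y = e (g x) (g y) by rewrite -he !gK.
have KE x : (x \in K) = k (g x) by rewrite -eK gK.
split=> [/maxsetP[/forall_inP clK maxK]|/forallP maxK].
  apply/forallP => v; case: ifP => kv.
    apply/forallP => w; apply/implyP => kw; apply/implyP => nvw.
    have /forall_inP/(_ (h w)) := clK (h v) (etrans (eK v) kv).
    by rewrite eK kw he (can_eq hK) nvw => /(_ isT).
  apply: contraT => /existsPn Hv.
  have : clique (h v |: K).
    have Hw w : k w -> e v w by move=> kw; have := Hv w; rewrite kw negbK.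
    apply/forall_inP => x; rewrite !inE => /orP[/eqP->|xK];
      apply/forall_inP => y; rewrite !inE => /orP[/eqP->|yK].
    - by rewrite eqxx.
    - by rewrite adjE hK Hw ?implybT // -KE.
    - by rewrite adjE hK e_sym Hw ?implybT // -KE.
    - by have /forall_inP/(_ y yK) := clK x xK.
  move=> /maxK/(_ (subsetUr _ _)) eKv.
  by move: kv; rewrite -eK -eKv setU11.
apply/maxsetP; split.
  apply/forall_inP => x xK; apply/forall_inP => y yK; apply/implyP => nxy.
  have := maxK (g x); rewrite -KE xK => /forallP/(_ (g y)).
  by rewrite -KE yK (can_eq gK) nxy -adjE.
move=> B /forall_inP clB /subsetP KB; apply/eqP; rewrite eqEsubset andbC.
apply/andP; split; apply/subsetP => // x xB; apply/negPn/negP => xK.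
have := maxK (g x); rewrite -KE (negbTE xK) => /existsP[y].
rewrite -eK => /andP[yK]; rewrite -he gK.
have /forall_inP/(_ (h y) (KB _ yK)) := clB x xB.
case: eqP => [exy|_ /= -> //]; by rewrite exy yK in xK.
Qed.

Lemma TwoCC_abs : TwoCC G <-> abs_2cc e.
Proof.
case: (h_bij) => g hK gK.
have adjE x y : adj x y = e (g x) (g y) by rewrite -he !gK.
split=> [[[sG iG] [c Hc]]|[sG iG [c Hc]]].
  have e_sym : symmetric e by move=> u v; rewrite -!he sG.
  split=> // [v|]; first by rewrite -he iG.
  exists (c \o h) => k mk; apply: contraT => /existsPn nk.
  pose K := [set x | k (g x)].
  have mK : maxset (@clique G) K.
    by apply/(@maxset_clique_abs K k) => // v; rewrite inE hK.
  (* The color of [K] is that of any of its elements; an empty [K] is monochromatic too and needs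
     its own case. *)
  case: (Hc _ mK); case: (pickP k) => [u ku|k0].
    exists (c (h u)) => x; rewrite inE => kx.
    have /existsPn/(_ (g x)) := nk u.
    by rewrite ku kx /= gK negbK => /eqP.
  by exists true => x; rewrite inE k0.
have e_sym : symmetric e by [].
split; first by split=> [x y|x]; rewrite !adjE.
exists (c \o g) => K mK [b Hb].
have mk : max_clique e [pred v | h v \in K] by apply/(@maxset_clique_abs K).
have /existsP[u /existsP[v /and3P[Ku Kv]]] := Hc _ mk.
by have /= := Hb _ Ku; have /= := Hb _ Kv; rewrite !hK => -> ->; rewrite eqxx.
Qed.

End GraphTransport.

Section Isomorphism.

Lemma isomorphic_nf (A A' : structure sigma_cnf) : isomorphic A A' ->
  exists2 f : univ A -> univ A', bijective f &
    [/\ forall v, nf_exist (f v) = nf_exist v,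
        forall u v, nf_pos (f u) (f v) = nf_pos u v &
        forall u v, nf_neg (f u) (f v) = nf_neg u v].
Proof.
case=> f [f_bij fR _]; exists f => //; split=> [v|u v|u v]; rewrite -?fR.
- by rewrite /nf_exist -(fR SymE); congr rel_of; apply: val_inj.
- by rewrite /nf_pos -(fR SymPos); congr rel_of; apply: val_inj.
- by rewrite /nf_neg -(fR SymNeg); congr rel_of; apply: val_inj.
Qed.

(** Both structures are compared with the abstract problem over [univ A], one along the identity,
    the other along the isomorphism; the other three closure proofs are alike. *)
Lemma decision_QSat2 : decision_problem QSat2.
Proof.
move=> A A' /isomorphic_nf[f f_bij [fE fP fN]].
have idb : bijective (@id (univ A)) by exists id.
apply: iff_trans (iff_sym (QSat2_abs f_bij fE fP fN)).
exact: (@QSat2_abs A _ id).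
Qed.

Lemma decision_QUnsat2 : decision_problem QUnsat2.
Proof.
move=> A A' /isomorphic_nf[f f_bij [fE fP fN]].
have idb : bijective (@id (univ A)) by exists id.
apply: iff_trans (iff_sym (QUnsat2_abs f_bij fE fP fN)).
exact: (@QUnsat2_abs A _ id).
Qed.

Lemma decision_ExistsUniqueSat : decision_problem ExistsUniqueSat.
Proof.
move=> A A' /isomorphic_nf[f f_bij [fE fP fN]].
have idb : bijective (@id (univ A)) by exists id.
apply: iff_trans (iff_sym (ExistsUniqueSat_abs f_bij fE fP fN)).
exact: (@ExistsUniqueSat_abs A _ id).
Qed.

Lemma decision_TwoCC : decision_problem TwoCC.
Proof.
move=> A A' [f [f_bij fR _]].
have idb : bijective (@id (univ A)) by exists id.
apply: iff_trans (@TwoCC_abs A _ id idb (@adj A) _) (iff_sym _) => //.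
apply: (@TwoCC_abs A' _ f f_bij (@adj A)).
by move=> u v; rewrite /adj -(fR tt); congr rel_of; apply: val_inj.
Qed.

End Isomorphism.

(** * Reductions from unsatisfiability *)

Lemma satP (V : finType) (occ : bool -> rel V) (a : pred V) :
  reflect (forall x, exists b y, occ b x y && (a y == b))
          (sat (occ true) (occ false) a).
Proof.
apply: (iffP forallP) => H x.
  have /existsP[y /orP[]/andP[o ay]] := H x.
    by exists true, y; rewrite o ay.
  by exists false, y; rewrite o (negbTE ay).
have [b [y /andP[o /eqP ay]]] := H x; apply/existsP; exists y.
by rewrite ay; case: b o {ay} => ->; rewrite ?orbT.
Qed.

(** * Unique satisfiability *)

Variant eu_role := Variable_role | Clause_role | Guard_role.

Definition eu_role_code r :=
  match r with
  | Variable_role => Some true | Clause_role => Some false | Guard_role => None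
  end.
Definition eu_role_decode o :=
  match o with
  | Some true => Variable_role | Some false => Clause_role | None => Guard_role
  end.
Lemma eu_role_codeK : cancel eu_role_code eu_role_decode.
Proof. by case. Qed.
HB.instance Definition _ := Finite.copy eu_role (can_type eu_role_codeK).

Section ExistsUnique.
Variables (V : finType) (v0 : V) (E : pred V) (occ : bool -> rel V).

(** Elements with [Clause_role] serve only as clause indices. As variables they occur nowhere, and
    they are made existential lest their free values destroy uniqueness. *)
Definition eu_exist : pred (eu_role * V) := fun x =>
  match x.1 with
  | Variable_role => E x.2
  | Clause_role => true
  | Guard_role => false
  end.

(* Writing g for the variable [(Guard_role, v0)], the clauses are "C or g" for
   every old clause C and "v or not g" for every non-existential variable v. *)
Definition eu_occ (b : bool) : rel (eu_role * V) := fun x y =>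
  match x.1, y.1 with
  | Variable_role, Variable_role => (x.2 == y.2) && (b || E x.2)
  | Variable_role, Guard_role => ~~ b && (y.2 == v0)
  | Clause_role, Variable_role => occ b x.2 y.2
  | Clause_role, Guard_role => b && (y.2 == v0)
  | Guard_role, Guard_role => if b then x.2 == y.2 else y.2 == v0
  | _, _ => false
  end.

Let g0 : eu_role * V := (Guard_role, v0).
Let esat := sat (eu_occ true) (eu_occ false).

Let esat_true s : esat (mix eu_exist s predT).
Proof.
apply/satP => -[[] v].
- case Ev: (E v); last first.
    exists true, (Variable_role, v).
    by rewrite /eu_occ /mix /eu_exist /= Ev !eqxx.
  (* At an existential [v] the clause contains both signs of [v], so the current value satisfies
     it. *)
  exists (mix eu_exist s predT (Variable_role, v)), (Variable_role, v).
  by rewrite /eu_occ /= !eqxx Ev orbT.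
- by exists true, g0; rewrite /eu_occ /mix /= !eqxx.
- by exists true, (Guard_role, v); rewrite /eu_occ /mix /= !eqxx.
Qed.

(** With g true, the clause of a non-existential variable loses its literal [not g] and is left with
    that variable alone. *)
Let esat_guard a : esat a -> a g0 ->
  forall x, ~~ eu_exist x -> a x.
Proof.
move=> /satP sa ag x nEx; have [b [y /andP[o /eqP ay]]] := sa x.
move: nEx o ay; rewrite /eu_exist /eu_occ; case: x y => [[] v] [[] w] //= nEv.
- by rewrite (negbTE nEv) orbF => /andP[/eqP<- ->].
- by case/andP=> nb /eqP-> ab; move: nb; rewrite -ab ag.
- by case: b => [/eqP-> -> //|/eqP->]; rewrite -/g0 ag.
Qed.

Let esat_sat a : esat a -> ~~ a g0 ->
  sat (occ true) (occ false) (fun v => a (Variable_role, v)).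
Proof.
move=> /satP sa ag; apply/satP => u.
have [b [[[] w] /andP[]]] := sa (Clause_role, u); rewrite /eu_occ //=.
  by move=> o ab; exists b, w; rewrite o.
by move=> /andP[bT /eqP->] /eqP ab; rewrite ab bT in ag.
Qed.

Let sat_esat (a : pred (eu_role * V)) :
  sat (occ true) (occ false) (fun v => a (Variable_role, v)) ->
  (forall v, a (Guard_role, v) = false) -> esat a.
Proof.
move=> /satP sa ag; apply/satP => -[[] v].
- by exists false, g0; rewrite /eu_occ /= eqxx ag.
- have [b [w H]] := sa v; by exists b, (Variable_role, w).
- by exists false, g0; rewrite /eu_occ /= eqxx ag.
Qed.

Lemma qunsat_eusat :
  abs_qunsat E (occ true) (occ false) <->
  abs_eusat eu_exist (eu_occ true) (eu_occ false).
Proof.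
split=> [[s Hs]|[s [t [_ Ht]]]].
  exists (fun x => s x.2), predT; split; first exact: esat_true.
  move=> t' st' x nEx.
  case: (boolP (mix eu_exist (s \o snd) t' g0)) => g.
    by have := esat_guard st' g nEx; rewrite /mix (negbTE nEx) => ->.
  have /negP[] := Hs (fun v => t' (Variable_role, v)).
  exact: esat_sat st' g.
exists (fun v => s (Variable_role, v)) => t'; apply/negP => st'.
(* The all-true assignment is always a solution, so uniqueness makes g true in [t]; a solution of
   the old CNF, extended by g false, would then be a second one. *)
have tg : t g0 by rewrite -(Ht predT) ?esat_true.
pose t'' (x : eu_role * V) := if x.1 is Variable_role then t' x.2 else false.
have /Ht/(_ g0 isT) : esat (mix eu_exist s t'').
  exact: sat_esat.
by rewrite tg.
Qed.

End ExistsUnique.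

(** * Clique coloring *)

Variant gadget := Lit of option bool | Anchor of option bool | Clause | Hub.

Definition gadget_code (k : gadget) : option bool + option bool + bool :=
  match k with
  | Lit s => inl (inl s) | Anchor s => inl (inr s)
  | Clause => inr true | Hub => inr false
  end.
Definition gadget_decode (c : option bool + option bool + bool) : gadget :=
  match c with
  | inl (inl s) => Lit s | inl (inr s) => Anchor s
  | inr true => Clause | inr false => Hub
  end.
Lemma gadget_codeK : cancel gadget_code gadget_decode.
Proof. by case. Qed.
HB.instance Definition _ := Finite.copy gadget (can_type gadget_codeK).

Section CliqueColoring.
Variables (V : finType) (v0 : V) (E : pred V) (occ : bool -> rel V).

Definition lit_link (s s' : option bool) : bool :=
  (s != s') && ((s == None) || (s' == None)).

(** At an existential variable the anchors of the two signs are linked, which makes the two literals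
    differ in color; at a universal one both anchors are linked to the hubs instead, which gives
    both literals the color of the hubs. *)
Definition anchor_link (s s' : option bool) : bool :=
  [&& s != s', s != None & s' != None].

(* [Lit (Some b)] is the literal of sign [b], and [Lit None] an extra vertex
   adjacent to all literals and clauses, which rules out monochromatic cliques of
   the color of the clauses.  The other edges are maximal cliques, so their ends
   have different colors: hubs are "true", clauses "false", and a literal has the
   color opposite to its anchor.  The copies of [Lit None] and [Hub], one for each
   element of [V], are harmless. *)
Definition gadj (x y : gadget * V) : bool :=
  match x.1, y.1 with
  | Lit s, Lit s' => (x.2 != y.2) || lit_link s s'
  | Lit s, Anchor s' | Anchor s', Lit s => (s == s') && (x.2 == y.2)
  | Lit s, Clause => if s is Some b then ~~ occ b y.2 x.2 else true
  | Clause, Lit s => if s is Some b then ~~ occ b x.2 y.2 else true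
  | Anchor s, Anchor s' => [&& x.2 == y.2, E x.2 & anchor_link s s']
  | Anchor s, Hub => (s == None) || ~~ E x.2
  | Hub, Anchor s => (s == None) || ~~ E y.2
  | Clause, Hub | Hub, Clause => true
  | _, _ => false
  end.

Lemma lit_linkC s s' : lit_link s s' = lit_link s' s.
Proof. by rewrite /lit_link eq_sym orbC. Qed.

Lemma anchor_linkC s s' : anchor_link s s' = anchor_link s' s.
Proof. by rewrite /anchor_link eq_sym; congr (_ && _); rewrite andbC. Qed.

Lemma gadj_sym : symmetric gadj.
Proof.
move=> [[s|s||] u] [[s'|s'||] v] //=; rewrite /gadj /=.
- by rewrite eq_sym lit_linkC.
- by rewrite [u == v]eq_sym.
- by rewrite [u == v]eq_sym.
- by rewrite anchor_linkC [u == v]eq_sym; case: eqP => // ->.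
Qed.

Lemma gadj_irr : irreflexive gadj.
Proof.
by move=> [[s|s||] u]; rewrite /gadj //= /lit_link /anchor_link ?eqxx ?andbF.
Qed.

Section Coloring.
Variable c : pred (gadget * V).
Hypothesis good : forall K : pred (gadget * V), max_clique gadj K ->
  [exists x, exists y, [&& K x, K y & c x != c y]].

(** An edge that lies in no triangle is a maximal clique, so its ends cannot share a color. *)
Lemma edge_coloring x y :
  gadj x y -> (forall z, gadj x z -> ~~ gadj y z) -> c x = ~~ c y.
Proof.
move=> axy notri; pose K := [pred z | (z == x) || (z == y)].
have ayx : gadj y x by rewrite gadj_sym.
have/good/existsP[u /existsP[w /and3P[/= Ku Kw]]] : max_clique gadj K.
  apply/forallP => z /=; case: ifP => Kz.
    apply/forallP => w; apply/implyP => Kw; apply/implyP.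
    by move: Kz Kw => /orP[]/eqP-> /orP[]/eqP->; rewrite ?eqxx.
  apply/existsP; case: (boolP (gadj x z)) => [axz|naxz].
    by exists y; rewrite /= eqxx orbT gadj_sym notri.
  by exists x; rewrite /= eqxx gadj_sym.
case/orP: Ku => /eqP->; case/orP: Kw => /eqP->; rewrite ?eqxx //.
  by case: (c x); case: (c y).
by case: (c x); case: (c y).
Qed.

Lemma anchor_coloring s u : (s == None) || ~~ E u ->
  c (Anchor s, u) = ~~ c (Hub, v0).
Proof.
move=> H; apply: edge_coloring => // -[[s'|s'||] w] //; rewrite /gadj //=.
by case/orP: H => [/eqP->|/negbTE->]; rewrite /anchor_link ?eqxx ?andbF.
Qed.

Lemma lit_anchor_coloring s u : c (Lit s, u) = ~~ c (Anchor s, u).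
Proof.
apply: edge_coloring; first by rewrite /gadj /= !eqxx.
move=> [[s'|s'||] w]; rewrite /gadj //=.
  by case/orP=> [/negbTE->|/andP[]]; rewrite ?andbF // eq_sym => /negbTE->.
by case/andP=> /eqP-> _; rewrite /anchor_link eqxx !andbF.
Qed.

Lemma lit_forced s u : (s == None) || ~~ E u -> c (Lit s, u) = c (Hub, v0).
Proof. by move=> H; rewrite lit_anchor_coloring anchor_coloring ?negbK. Qed.

(** The path from one literal through the two anchors to the opposite literal flips the color three
    times. *)
Lemma lit_exist b u :
  E u -> c (Lit (Some b), u) = (c (Lit (Some true), u) == b).
Proof.
move=> Eu; case: b; first by case: (c _).
rewrite !lit_anchor_coloring.
rewrite (@edge_coloring (Anchor (Some false), u) (Anchor (Some true), u)).
- by case: (c _).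
- by rewrite /gadj /= eqxx Eu.
move=> [[s'|s'||] w]; rewrite /gadj //=; last by rewrite Eu.
  by case/andP=> /eqP->.
by case/and3P=> _ _; case: s' => [[]|]; rewrite /anchor_link /= ?andbF.
Qed.

End Coloring.

Lemma qunsat_2cc : abs_qunsat E (occ true) (occ false) <-> abs_2cc gadj.
Proof.
split=> [[s Hs]|[_ _ [c good]]].
  split; [exact: gadj_sym | exact: gadj_irr |].
  pose lit_col (o : option bool) v :=
    if o is Some b then ~~ E v || (s v == b) else true.
  pose c (x : gadget * V) := match x.1 with
    | Lit o => lit_col o x.2 | Anchor o => ~~ lit_col o x.2
    | Clause => false | Hub => true end.
  exists c => K mK; apply: contraT => nK.
  have mono x y : K x -> K y -> c x = c y.
    move=> Kx Ky; move/existsPn/(_ x)/existsPn/(_ y): nK.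
    by rewrite Kx Ky negbK => /eqP.
  move/forallP: mK => mK.
  have cl x y : K x -> K y -> x != y -> gadj x y.
    move=> Kx Ky nxy; have := mK x; rewrite Kx => /forallP/(_ y).
    by rewrite Ky nxy.
  (* If all neighbors of [x] have the other color, a monochromatic [K] containing [x] is just the
     singleton of [x], which the neighbor [y] extends. This excludes hubs and anchors. *)
  have alt x y : gadj x y -> (forall z, gadj x z -> c z != c x) -> ~~ K x.
    move=> axy Hx; apply/negP => Kx.
    have only z : K z -> z = x.
      move=> Kz; apply/eqP; apply: contraT; rewrite eq_sym => nxz.
      by have := Hx z (cl _ _ Kx Kz nxz); rewrite (mono z x) ?eqxx.
    have Ky : K y = false.
      by apply/negP => /only exy; rewrite exy gadj_irr in axy.
    have := mK y; rewrite Ky => /existsP[z /andP[/only->]].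
    by rewrite gadj_sym axy.
  have nhub v : ~~ K (Hub, v).
    apply: (@alt _ (Clause, v)) => // -[[o|o||] w] //; rewrite /gadj /c //=.
    by case: o => [b|] //= nE; rewrite /lit_col nE.
  have nanc o v : ~~ K (Anchor o, v).
    apply: (@alt _ (Lit o, v)); first by rewrite /gadj /= !eqxx.
    move=> [[o'|o'||] w]; rewrite /gadj /c //=.
    - by case/andP=> /eqP-> /eqP->; case: (lit_col _ _).
    - case/and3P=> /eqP<- Ev; rewrite /lit_col Ev.
      by case: o o' => [[]|] [[]|] //=; case: (s v).
    - by case: o => [b|] //= nE; rewrite /lit_col nE.
  (* Apart from itself, this vertex is non-adjacent only to anchors and hubs, which are not in [K];
     so maximality puts it in [K], and the color of [K] is true. *)
  have Kd : K (Lit None, v0).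
    apply: contraT => nKd; have := mK (Lit None, v0).
    rewrite (negbTE nKd) => /existsP[[[o|o||] w]] /andP[Kx].
    - rewrite /gadj /= /lit_link /= ?orbT ?andbT negb_or !negbK.
      case/andP=> /eqP e /eqP eo.
      by rewrite -e -eo in Kx; rewrite Kx in nKd.
    - by rewrite (negbTE (nanc _ _)) in Kx.
    - by [].
    - by rewrite (negbTE (nhub _)) in Kx.
  have Kt x : K x -> c x by move=> Kx; rewrite (mono _ _ Kx Kd).
  (* A clause has color false and so is outside [K]; by maximality some literal of [K] is not
     adjacent to it, that is, occurs in it. That literal is true: by its color if existential, and
     since [K] never has both signs if universal. *)
  have := Hs (fun v => K (Lit (Some true), v)); case/negP; apply/satP => u.
  have nKu : K (Clause, u) = false by apply/negP => /Kt.
  have := mK (Clause, u); rewrite nKu => /existsP[[[o|o||] w]] /andP[Kx].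
  - rewrite /gadj /=; case: o Kx => [b|//] Kx; rewrite negbK => o.
    exists b, w; rewrite o /mix /=; have := Kt _ Kx; rewrite /c /=.
    case: ifP => //= Ew _; case: b Kx {o} => Kx; first by rewrite Kx.
    apply/eqP/negP => Kx'; have := cl _ _ Kx Kx'.
    by rewrite /gadj /= eqxx /lit_link /= => /(_ isT).
  - by rewrite (negbTE (nanc _ _)) in Kx.
  - by have := Kt _ Kx.
  - by rewrite (negbTE (nhub _)) in Kx.
(* Colors are determined only up to a swap, so the color of the hubs is taken to mean true. *)
pose t := c (Hub, v0).
exists (fun v => c (Lit (Some true), v) == t) => a; apply/negP => /satP sa.
set m := mix _ _ _ in sa.
(* The literals true under [m], with all the extra vertices. A clause cannot be added because it
   contains a true literal, so [K] is maximal although all of it has color [t]. *)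
pose K (x : gadget * V) :=
  if x.1 is Lit o then (if o is Some b then m x.2 == b else true) else false.
have/good/existsP[x /existsP[y /and3P[Kx Ky]]] : max_clique gadj K.
  apply/forallP => -[[o|o||] v]; rewrite /K /=.
  - case: ifP => Ko.
      apply/forallP => -[[o'|o'||] w] //=; apply/implyP => Ko'; apply/implyP.
      rewrite /gadj /= xpair_eqE negb_and; case: (altP (v =P w)) => //= evw.
      rewrite orbF => noo'; have {}noo' : o != o' by [].
      rewrite /lit_link noo' -evw in Ko' *.
      case: o o' Ko Ko' noo' => [b|] [b'|] //= /eqP-> /eqP->.
      by rewrite eqxx.
    case: o Ko => [b|] // Ko; apply/existsP.
    exists (Lit (Some (m v)), v).
    by rewrite /= eqxx /gadj /= eqxx /lit_link andbF.
  - apply/existsP; case: o => [b|]; first by exists (Lit None, v).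
    by exists (Lit (Some (m v)), v); rewrite /= eqxx.
  - have [b [w /andP[o mw]]] := sa v; apply/existsP.
    by exists (Lit (Some b), w); rewrite /= mw /gadj /= o.
  - by apply/existsP; exists (Lit None, v).
have Kc x' : K x' -> c x' = t.
  case: x' => [[[b|]|o||] v] //; rewrite /K /= => Km; last exact: lit_forced.
  move: Km; rewrite /m /mix; case: ifP => [Ev|/negbT nEv _].
    rewrite /= (lit_exist good b Ev) /t.
    by case: b; case: (c (Lit _, v)); case: (c (Hub, v0)).
  by apply: lit_forced => //; rewrite nEv.
by rewrite !Kc ?eqxx.
Qed.

End CliqueColoring.

(** * Projections given tag by tag *)

Section Renaming.
Variable tau : vocabulary.

Definition tmap V V' (x : V -> V') (t : term tau V) : term tau V' :=
  match t with
  | Var v => Var _ (x v) | Con c => Con _ c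
  | Zero => Zero | One => One | Max => Max
  end.

Definition amap V V' (x : V -> V') (a : atom tau V) : atom tau V' :=
  match a with
  | Rel r ts => Rel (map_tuple (tmap x) ts)
  | Eq s t => Eq (tmap x s) (tmap x t)
  | Le s t => Le (tmap x s) (tmap x t)
  | Bit s t => Bit (tmap x s) (tmap x t)
  | Plus s t u => Plus (tmap x s) (tmap x t) (tmap x u)
  | Times s t u => Times (tmap x s) (tmap x t) (tmap x u)
  | Suc s t => Suc (tmap x s) (tmap x t)
  end.

Fixpoint fmap V V' (x : V -> V') (phi : formula tau V) : formula tau V' :=
  match phi with
  | Atom a => Atom (amap x a)
  | Not p => Not (fmap x p)
  | And p q => And (fmap x p) (fmap x q)
  | Or p q => Or (fmap x p) (fmap x q)
  | Ex p => Ex (fmap (omap x) p)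
  | All p => All (fmap (omap x) p)
  end.

Variable A : structure tau.

Lemma teval_tmap V V' (x : V -> V') (e : V' -> univ A) t :
  teval e (tmap x t) = teval (e \o x) t.
Proof. by case: t. Qed.

Lemma eq_teval V (e e' : V -> univ A) : e =1 e' -> @teval _ A _ e =1 teval e'.
Proof. by move=> ee []. Qed.

Lemma aeval_amap V V' (x : V -> V') (e : V' -> univ A) a :
  aeval e (amap x a) = aeval (e \o x) a.
Proof.
case: a => [r ts|s t|s t|s t|s t u|s t u|s t] /=; rewrite ?teval_tmap //.
congr rel_of; apply: val_inj; rewrite /= -map_comp.
by apply: eq_map => t; apply: teval_tmap.
Qed.

Lemma eq_aeval V (e e' : V -> univ A) : e =1 e' -> @aeval _ A _ e =1 aeval e'.
Proof.
move=> ee a; have te := eq_teval ee.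
case: a => [r ts|s t|s t|s t|s t u|s t u|s t] /=; rewrite ?te //.
by congr rel_of; apply: val_inj; apply: eq_map.
Qed.

Lemma eq_scons V (e e' : V -> univ A) x : e =1 e' -> scons x e =1 scons x e'.
Proof. by move=> ee []. Qed.

Lemma eq_eval V (e e' : V -> univ A) phi : e =1 e' -> eval e phi = eval e' phi.
Proof.
elim: phi e e' => {V} [V a|V p IH|V p IHp q IHq|V p IHp q IHq|V p IH|V p IH]
  e e' ee /=.
- exact: eq_aeval.
- by rewrite (IH _ _ ee).
- by rewrite (IHp _ _ ee) (IHq _ _ ee).
- by rewrite (IHp _ _ ee) (IHq _ _ ee).
- by apply: eq_existsb => u; apply: IH; apply: eq_scons.
- by apply: eq_forallb => u; apply: IH; apply: eq_scons.
Qed.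

Lemma eval_fmap V V' (x : V -> V') (e : V' -> univ A) phi :
  eval e (fmap x phi) = eval (e \o x) phi.
Proof.
elim: phi V' x e => {V}
  [V a|V p IH|V p IHp q IHq|V p IHp q IHq|V p IH|V p IH] V' x e /=.
- exact: aeval_amap.
- by rewrite IH.
- by rewrite IHp IHq.
- by rewrite IHp IHq.
- by apply: eq_existsb => u; rewrite IH; apply: eq_eval => -[].
- by apply: eq_forallb => u; rewrite IH; apply: eq_eval => -[].
Qed.

Lemma numeric_tmap V V' (x : V -> V') t :
  numeric_term (tmap x t : term tau V') = numeric_term t.
Proof. by case: t. Qed.

Lemma numeric_fmap V V' (x : V -> V') phi : numeric (fmap x phi) = numeric phi.
Proof.
elim: phi V' x => {V}
  [V a|V p IH|V p IHp q IHq|V p IHp q IHq|V p IH|V p IH] V' x /=;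
  rewrite ?IH ?IHp ?IHq //.
by case: a => *; rewrite /= ?numeric_tmap.
Qed.

Definition top V : formula tau V := Atom (Eq Zero Zero).
Definition conjs V (s : seq (formula tau V)) := foldr (@And tau V) (top V) s.
Definition disjs V (s : seq (formula tau V)) :=
  foldr (@Or tau V) (Not (top V)) s.

Lemma eval_top V (e : V -> univ A) : eval e (top V).
Proof. exact: eqxx. Qed.

Lemma eval_conj V (e : V -> univ A) s : eval e (conjs s) = all (eval e) s.
Proof. by elim: s => [|p s IH] /=; rewrite ?eqxx ?IH. Qed.

Lemma eval_disj V (e : V -> univ A) s : eval e (disjs s) = has (eval e) s.
Proof. by elim: s => [|p s IH] /=; rewrite ?eqxx ?IH. Qed.

Lemma eval_conj_fin V (e : V -> univ A) (J : finType) (F : J -> formula tau V) :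
  eval e (conjs [seq F j | j <- enum J]) = [forall j, eval e (F j)].
Proof.
rewrite eval_conj all_map; apply/allP/forallP => [H j|H j _]; last exact: H.
by apply: H; rewrite mem_enum.
Qed.

Lemma eval_disj_fin V (e : V -> univ A) (J : finType) (F : J -> formula tau V) :
  eval e (disjs [seq F j | j <- enum J]) = [exists j, eval e (F j)].
Proof.
rewrite eval_disj has_map; apply/hasP/existsP => [[j _ H]|[j H]]; exists j => //.
by rewrite mem_enum.
Qed.

Lemma numeric_conj V (s : seq (formula tau V)) :
  numeric (conjs s) = all (@numeric tau V) s.
Proof. by elim: s => //= p s ->. Qed.

Lemma numeric_disj V (s : seq (formula tau V)) :
  numeric (disjs s) = all (@numeric tau V) s.
Proof. by elim: s => //= p s ->. Qed.

Lemma eval_guarded_disj V (e : V -> univ A) a0 s :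
  eval e (guarded_disj a0 s) =
  eval e a0 || has (fun p => eval e p.1 && eval e p.2) s.
Proof.
elim: s a0 => [|p s IH] a0 /=; first by rewrite orbF.
by rewrite IH /= orbA.
Qed.

Definition lit_formula V (l : bool * atom tau V) : formula tau V :=
  if l.1 then Atom l.2 else Not (Atom l.2).

Lemma eval_lit_formula V (e : V -> univ A) l :
  eval e (lit_formula l) = (aeval e l.2 == l.1).
Proof. by case: l => [[] a]; rewrite /lit_formula /=; case: aeval. Qed.

End Renaming.

Section TaggedQuery.
Variables (tau : vocabulary) (F : relfamily) (T W : finType).
Hypothesis T_gt1 : 1 < #|T|.

(** For each tuple of tags, a triple (base, guard, literal) stands for base or (guard and literal):
    at most one input literal is tested per tuple of tags. *)
Definition rel_spec : Type := forall r : F, {ffun 'I_(arity r) -> T} ->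
  formula tau ('I_(arity r) * W) * formula tau ('I_(arity r) * W)
  * (bool * atom tau ('I_(arity r) * W)).

Definition valid_spec (spec : rel_spec) : Prop := forall r f,
  [/\ numeric (spec r f).1.1, numeric (spec r f).1.2 &
      forall (A : structure tau) (e : _ -> univ A),
        ~~ (eval e (spec r f).1.1 && eval e (spec r f).1.2)].

Variable spec : rel_spec.
Hypothesis spec_valid : valid_spec spec.

(* Elements of the image are pairs of a tag and a [W]-indexed tuple; the tag is
   coded in unary by a tuple of zeros with a single one. *)
Let k := #|{: T + W}|.
Let tag_pos (t : T) : 'I_k := enum_rank (inl t : T + W).
Let val_pos (w : W) : 'I_k := enum_rank (inr w : T + W).

Let has_tag V (x : 'I_k -> V) (t : T) : formula tau V :=
  conjs [seq Atom (Eq (Var _ (x (tag_pos t'))) (if t' == t then One else Zero))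
       | t' <- enum T].

Let dom_formula : formula tau 'I_k := disjs [seq has_tag id t | t <- enum T].

Section Points.
Variable A : structure tau.

Definition point_of (p : T * {ffun W -> univ A}) : k.-tuple (univ A) :=
  [tuple match enum_val i with
         | inl t => if t == p.1 then one_of A else zero_of A
         | inr w => p.2 w
         end | i < k].

Lemma point_of_tag p t :
  tnth (point_of p) (tag_pos t) = if t == p.1 then one_of A else zero_of A.
Proof. by rewrite tnth_mktuple enum_rankK. Qed.

Lemma point_of_val p w : tnth (point_of p) (val_pos w) = p.2 w.
Proof. by rewrite tnth_mktuple enum_rankK. Qed.

Lemma one_zero : (one_of A == zero_of A) = false.
Proof. by []. Qed.

Lemma point_of_inj : injective point_of.
Proof.
move=> [t e] [t' e'] eqp; congr pair.
  have := point_of_tag (t, e) t; rewrite eqp point_of_tag /= eqxx.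
  by case: eqP => // _ /esym/eqP; rewrite one_zero.
by apply/ffunP => w; rewrite -(point_of_val (t, e)) eqp point_of_val.
Qed.

Lemma eval_has_tag V (x : 'I_k -> V) (e : V -> univ A) t :
  eval e (has_tag x t) =
  [forall t', e (x (tag_pos t')) == if t' == t then one_of A else zero_of A].
Proof.
by rewrite eval_conj_fin; apply: eq_forallb => t' /=; case: (t' == t).
Qed.

Lemma has_tag_point V (x : 'I_k -> V) (e : V -> univ A) p t :
  (forall i, e (x i) = tnth (point_of p) i) ->
  eval e (has_tag x t) = (t == p.1).
Proof.
move=> ex; rewrite eval_has_tag; apply/forallP/eqP => [/(_ t)|-> t'].
  by rewrite ex point_of_tag eqxx; case: (t =P p.1).
by rewrite ex point_of_tag.
Qed.

Lemma has_tag_uniq V (x : 'I_k -> V) (e : V -> univ A) t t' :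
  eval e (has_tag x t) -> eval e (has_tag x t') -> t = t'.
Proof.
rewrite !eval_has_tag => /forallP/(_ t) + /forallP/(_ t).
by rewrite eqxx => /eqP->; case: (t =P t').
Qed.

Lemma dom_point : query_dom dom_formula A = [set point_of p | p in setT].
Proof.
apply/setP => b; rewrite inE eval_disj_fin; apply/existsP/imsetP => [[t]|[p _ ->]].
  rewrite eval_has_tag => /forallP Ht.
  exists (t, [ffun w => tnth b (val_pos w)]) => //; apply: eq_from_tnth => i.
  rewrite tnth_mktuple -[i in LHS]enum_valK; case: (enum_val i) => [t'|w] /=.
    exact/eqP/Ht.
  by rewrite ffunE.
by exists p.1; rewrite (@has_tag_point _ _ _ p).
Qed.

Lemma dom_gt1 : 1 < #|query_dom dom_formula A|.
Proof.
rewrite dom_point card_imset; last exact: point_of_inj.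
rewrite cardsT card_prod card_ffun (leq_trans T_gt1) // leq_pmulr //.
by rewrite expn_gt0 card_ord (ltnW (usize_gt1 A)).
Qed.

End Points.

Let tags (r : F) (f : {ffun 'I_(arity r) -> T}) :
    formula tau ('I_(arity r) * 'I_k) :=
  conjs [seq has_tag (pair j) (f j) | j <- enum 'I_(arity r)].

Let lift_var (r : F) (v : 'I_(arity r) * W) : 'I_(arity r) * 'I_k :=
  (v.1, val_pos v.2).

Let rel_base (r : F) : formula tau ('I_(arity r) * 'I_k) :=
  disjs [seq And (tags f) (fmap (@lift_var r) (spec f).1.1)
       | f <- enum {ffun 'I_(arity r) -> T}].

Let rel_guards (r : F) :
    seq (formula tau ('I_(arity r) * 'I_k) *
         formula tau ('I_(arity r) * 'I_k)) :=
  [seq (And (tags f) (fmap (@lift_var r) (spec f).1.2),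
        lit_formula ((spec f).2.1, amap (@lift_var r) (spec f).2.2))
  | f <- enum {ffun 'I_(arity r) -> T}].

Let rel_formula (r : rels (Vocabulary F void)) :=
  guarded_disj (rel_base r) (rel_guards r).

Lemma no_constant (A : structure tau) (c : void) :
  #|[set b in query_dom dom_formula A
       | eval (tnth b) (of_void (formula tau 'I_k) c)]| = 1.
Proof. by case: c. Qed.

Definition tagged_query : query tau (Vocabulary F void) :=
  @Query tau (Vocabulary F void) k dom_formula rel_formula _ dom_gt1 no_constant.


Lemma numeric_has_tag V (x : 'I_k -> V) t : numeric (has_tag x t).
Proof.
by rewrite numeric_conj all_map; apply/allP => t' _ /=; case: (t' == t).
Qed.

Lemma numeric_tags r f : numeric (@tags r f).
Proof.
by rewrite numeric_conj all_map; apply/allP => j _; apply: numeric_has_tag.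
Qed.

Lemma tags_uniq A (r : F) (e : _ -> univ A) (f f' : {ffun 'I_(arity r) -> T}) :
  eval e (tags f) -> eval e (tags f') -> f = f'.
Proof.
rewrite !eval_conj_fin => /forallP Hf /forallP Hf'.
by apply/ffunP => j; apply: has_tag_uniq (Hf j) (Hf' j).
Qed.

(** Guards for different tuples of tags exclude each other because a tuple of elements carries at
    most one tuple of tags; base and guard for the same tags do so by [spec_valid]. *)
Lemma tagged_query_fop : is_fop tagged_query.
Proof.
split=> [|r|[]].
  by rewrite numeric_disj all_map; apply/allP => t _; apply: numeric_has_tag.
exists (rel_base r), (rel_guards r); split=> //.
- have n0 : numeric (rel_base r).
    rewrite numeric_disj all_map; apply/allP => f _ /=.
    by rewrite numeric_tags numeric_fmap; case: (spec_valid f).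
  have n1 : all (@numeric _ _) (unzip1 (rel_guards r)).
    rewrite /unzip1 -map_comp all_map; apply/allP => f _ /=.
    by rewrite numeric_tags numeric_fmap; case: (spec_valid f).
  exact/andP.
- have nthE f0 i : i < #|{ffun 'I_(arity r) -> T}| ->
      nth (top _ _) (unzip1 (rel_guards r)) i =
      let f := nth f0 (enum {ffun 'I_(arity r) -> T}) i in
      And (tags f) (fmap (@lift_var r) (spec f).1.2).
    by move=> lti; rewrite /unzip1 -map_comp (nth_map f0) // -cardE.
  have base_guard A (e : _ -> univ A) i :
      i < #|{ffun 'I_(arity r) -> T}| -> eval e (rel_base r) ->
      eval e (nth (top _ _) (unzip1 (rel_guards r)) i) -> False.
    rewrite eval_disj_fin => lti /existsP[f Hf]; rewrite (nthE f) //=.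
    have {Hf} /andP[tf] :
        eval e (tags f) && eval e (fmap (@lift_var r) (spec f).1.1) by [].
    rewrite eval_fmap => H1 /andP[tf']; rewrite eval_fmap.
    rewrite -(tags_uniq tf tf') => H2.
    have [_ _ excl] := spec_valid f.
    by have := excl A (e \o @lift_var r); rewrite H1 H2.
  have szs : size (unzip1 (rel_guards r)) = #|{ffun 'I_(arity r) -> T}|.
    by rewrite /unzip1 -map_comp size_map cardE.
  move=> A e [i lti] [j ltj]; rewrite !(tnth_nth (top _ _)) /= => ne_ij.
  apply/negP => /andP[].
  move: lti ltj ne_ij; rewrite /= szs.
  (* Index 0 is the base formula, and index [i.+1] is guard number [i]. *)
  case: i j => [|i] [|j] //= lti ltj ne_ij.
  + exact: base_guard.
  + by move=> H1 H2; apply: base_guard H2 H1.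
  have /card_gt0P[f0 _] : 0 < #|{ffun 'I_(arity r) -> T}|.
    exact: leq_ltn_trans (leq0n i) _.
  rewrite !(nthE f0) //= => /andP[t1 _] /andP[t2 _].
  have /eqP := tags_uniq t1 t2; rewrite nth_uniq ?enum_uniq -?cardE //.
  by move/eqP=> eij; case/eqP: ne_ij; apply: val_inj; rewrite /= eij.
- have : all (@literal _ _) (unzip2 (rel_guards r)) => //.
  rewrite /unzip2 -map_comp all_map; apply/allP => f _ /=.
  by rewrite /lit_formula; case: ifP.
Qed.

Variable A : structure tau.

Lemma point_in_dom p : point_of p \in query_dom dom_formula A.
Proof. by rewrite dom_point imset_f. Qed.

Definition query_elt (p : T * {ffun W -> univ A}) :
    univ (apply_query tagged_query A) :=
  enum_rank_in (point_in_dom p) (point_of p).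

Lemma query_eltK p : enum_val (query_elt p) = point_of p.
Proof. by rewrite enum_rankK_in // point_in_dom. Qed.

Lemma query_elt_bij : bijective query_elt.
Proof.
apply: inj_card_bij => [p q epq|].
  by apply: point_of_inj; rewrite -!query_eltK epq.
have -> : #|univ (apply_query tagged_query A)| = #|query_dom dom_formula A|.
  exact: card_ord.
by rewrite dom_point card_imset ?cardsT //; apply: point_of_inj.
Qed.

(** The tags of the arguments select one disjunct of the base and one guard; all others are
    false. *)
Lemma rel_of_query (r : F) (ps : (arity r).-tuple (T * {ffun W -> univ A})) :
  let s := spec [ffun j => (tnth ps j).1] in
  let e v := (tnth ps v.1).2 v.2 in
  @rel_of (Vocabulary F void) (apply_query tagged_query A) r
    (map_tuple query_elt ps) =
  eval e s.1.1 || eval e s.1.2 && (aeval e s.2.2 == s.2.1).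
Proof.
move=> s e; rewrite /apply_query /=.
set e' := fun v => _.
have e'E j i : e' (j, i) = tnth (point_of (tnth ps j)) i.
  by rewrite /e' /= tnth_map query_eltK.
have e'l v : e' (lift_var v) = e v by rewrite e'E point_of_val.
have tagsE f : eval e' (tags f) = (f == [ffun j => (tnth ps j).1]).
  rewrite eval_conj_fin; apply/forallP/eqP => [H|-> j].
    apply/ffunP => j; rewrite ffunE; apply/eqP.
    by rewrite -(@has_tag_point _ _ (pair j) e' (tnth ps j)).
  by rewrite (@has_tag_point _ _ (pair j) e' (tnth ps j)) ?ffunE.
have evE phi : eval e' (fmap (@lift_var r) phi) = eval e phi.
  by rewrite eval_fmap; apply: eq_eval.
rewrite /rel_formula eval_guarded_disj; congr (_ || _).
  rewrite eval_disj_fin; apply/existsP/idP => [[f]|H] /=.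
    by rewrite tagsE evE => /andP[/eqP->].
  by exists [ffun j => (tnth ps j).1]; rewrite /= tagsE eqxx evE.
rewrite has_map; apply/hasP/idP => [[f _]|H] /=.
  rewrite tagsE evE eval_lit_formula /= aeval_amap => /andP[/andP[/eqP-> ->]].
  by rewrite (eq_aeval (e' := e)).
exists [ffun j => (tnth ps j).1]; first by rewrite mem_enum.
rewrite /= tagsE eqxx evE eval_lit_formula /= aeval_amap.
by rewrite (eq_aeval (e' := e)).
Qed.

End TaggedQuery.

(** * Projections that produce formulas and graphs *)

(** Terms without constant symbols: equations between them are numeric and may appear in the guards
    of a projection. *)
Inductive nterm (V : Type) := NVar of V | NZero | NOne | NMax.
Arguments NZero {V}.
Arguments NOne {V}.
Arguments NMax {V}.

Definition term_of_nterm tau (V V' : Type) (x : V -> V') (t : nterm V) :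
    term tau V' :=
  match t with
  | NVar v => Var _ (x v) | NZero => Zero | NOne => One | NMax => Max
  end.

Definition neval tau (A : structure tau) V (e : V -> univ A) (t : nterm V) :=
  teval e (term_of_nterm tau id t).

Lemma teval_nterm tau (A : structure tau) V V' (x : V -> V')
    (e : V' -> univ A) t :
  teval e (term_of_nterm tau x t) = neval (e \o x) t.
Proof. by case: t. Qed.

Lemma eq_neval tau (A : structure tau) V (e e' : V -> univ A) :
  e =1 e' -> neval e =1 neval e'.
Proof. by move=> ee t; apply: eq_teval. Qed.

Lemma numeric_nterm tau V V' (x : V -> V') t :
  numeric_term (term_of_nterm tau x t).
Proof. by case: t. Qed.

Section Occurrences.
Variables (tau : vocabulary) (T W : finType).

(** Gives the tuple of a variable in terms of that of the clause. A coordinate with [None] is free,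
    so that one clause can contain a literal for every element of the universe. *)
Definition pattern : Type := W -> option (nterm W).

Definition pmatch (A : structure tau) (p : pattern)
    (e e' : {ffun W -> univ A}) : bool :=
  [forall w, if p w is Some t then neval e t == e' w else true].

Definition match_formula V (x y : W -> V) (p : pattern) : formula tau V :=
  conjs [seq if p w is Some t
            then Atom (Eq (term_of_nterm tau x t) (Var _ (y w)))
            else top tau V | w <- enum W].

Lemma eval_match_formula A V (x y : W -> V) p (e : V -> univ A)
    (ex ey : {ffun W -> univ A}) :
  e \o x =1 ex -> e \o y =1 ey ->
  eval e (match_formula x y p) = pmatch p ex ey.
Proof.
move=> exE eyE; rewrite eval_conj_fin; apply: eq_forallb => w.
case: (p w) => [t|]; last exact: eval_top.
by rewrite /= teval_nterm (eq_neval exE) -eyE.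
Qed.

Lemma numeric_match_formula V (x y : W -> V) p : numeric (match_formula x y p).
Proof.
rewrite numeric_conj all_map; apply/allP => w _ /=.
by case: (p w) => //= t; rewrite numeric_nterm.
Qed.

Definition idp : pattern := fun w => Some (NVar w).
Definition zerop : pattern := fun=> Some NZero.

Lemma pmatch_id (A : structure tau) (e e' : {ffun W -> univ A}) :
  pmatch idp e e' = (e == e').
Proof. by apply/forallP/eqP => [H|->] //; apply/ffunP => w; apply/eqP/H. Qed.

Definition zeros (A : structure tau) : {ffun W -> univ A} :=
  [ffun=> zero_of A].

Lemma pmatch_zero (A : structure tau) (e e' : {ffun W -> univ A}) :
  pmatch zerop e e' = (e' == zeros A).
Proof.
apply/forallP/eqP => [H|-> w]; last by rewrite ffunE.
by apply/ffunP => w; rewrite ffunE; apply/esym/eqP/H.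
Qed.

Definition triv_lit V : bool * atom tau V := (true, Eq Zero Zero).

(* [occ b c v = Some (p, l)]: the variable [(v, e')] occurs with sign [b] in the
   clause [(c, e)] iff [e'] matches [p] under [e], and [l] holds at [e]. *)
Definition occ_spec : Type :=
  bool -> T -> T -> option (pattern * (bool * atom tau W)).

Definition occ_sem (occ : occ_spec) (A : structure tau) (b : bool) :
    rel (T * {ffun W -> univ A}) :=
  fun x y => if occ b x.1 y.1 is Some (p, l)
             then pmatch p x.2 y.2 && (aeval x.2 l.2 == l.1) else false.

Section Triples.
Variable V : Type.

Definition triple : Type :=
  formula tau V * formula tau V * (bool * atom tau V).

Definition triple_valid (s : triple) : Prop :=
  [/\ numeric s.1.1, numeric s.1.2 &
      forall (A : structure tau) (e : V -> univ A),
        ~~ (eval e s.1.1 && eval e s.1.2)].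

Definition triple_eval (A : structure tau) (e : V -> univ A) (s : triple) :
    bool :=
  eval e s.1.1 || eval e s.1.2 && (aeval e s.2.2 == s.2.1).

Definition num_triple (phi : formula tau V) : triple :=
  (phi, Not (top tau V), triv_lit V).

Definition bool_triple (b : bool) : triple :=
  num_triple (if b then top tau V else Not (top tau V)).

Lemma num_triple_valid phi : numeric phi -> triple_valid (num_triple phi).
Proof. by move=> n_phi; split=> //= A e; rewrite ?eqxx andbF. Qed.

Lemma bool_triple_valid b : triple_valid (bool_triple b).
Proof. by apply: num_triple_valid; case: b. Qed.

Lemma eval_num_triple A (e : V -> univ A) phi :
  triple_eval e (num_triple phi) = eval e phi.
Proof. by rewrite /triple_eval /= ?eqxx orbF. Qed.

Lemma eval_bool_triple A (e : V -> univ A) b : triple_eval e (bool_triple b) = b.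
Proof. by rewrite eval_num_triple; case: b => /=; rewrite ?eqxx. Qed.

Variables (x y : W -> V) (occ : occ_spec).

Definition occ_triple b c v : triple :=
  if occ b c v is Some (p, l)
  then (Not (top tau V), match_formula x y p, (l.1, amap x l.2))
  else bool_triple false.

(** In graphs, adjacency means non-occurrence. It is again a projection: either no match, or a match
    and the complementary literal, and these guards are exclusive. *)
Definition nocc_triple b c v : triple :=
  if occ b c v is Some (p, l)
  then (Not (match_formula x y p), match_formula x y p, (~~ l.1, amap x l.2))
  else bool_triple true.

Lemma occ_triple_valid b c v : triple_valid (occ_triple b c v).
Proof.
rewrite /occ_triple; case: (occ b c v) => [[p l]|]; last exact: bool_triple_valid.
by split=> //=; apply: numeric_match_formula.
Qed.

Lemma nocc_triple_valid b c v : triple_valid (nocc_triple b c v).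
Proof.
rewrite /nocc_triple; case: (occ b c v) => [[p l]|]; last exact: bool_triple_valid.
split=> /= [||A e]; rewrite ?numeric_match_formula //.
by case: (eval e _).
Qed.

Variables (A : structure tau) (e : V -> univ A) (ex ey : {ffun W -> univ A}).
Hypotheses (exE : e \o x =1 ex) (eyE : e \o y =1 ey).

Lemma eval_occ_triple b c v :
  triple_eval e (occ_triple b c v) = occ_sem occ b (c, ex) (v, ey).
Proof.
rewrite /occ_triple /occ_sem /=.
case: (occ b c v) => [[p l]|]; last exact: eval_bool_triple.
rewrite /triple_eval /= ?eqxx /= (eval_match_formula _ exE eyE).
by rewrite aeval_amap (eq_aeval exE).
Qed.

Lemma eval_nocc_triple b c v :
  triple_eval e (nocc_triple b c v) = ~~ occ_sem occ b (c, ex) (v, ey).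
Proof.
rewrite /nocc_triple /occ_sem /=.
case: (occ b c v) => [[p l]|]; last exact: eval_bool_triple.
rewrite /triple_eval /= (eval_match_formula _ exE eyE).
rewrite aeval_amap (eq_aeval exE).
by case: pmatch; case: aeval; case: l.1.
Qed.

End Triples.

Definition side n (j : 'I_n) (w : W) : 'I_n * W := (j, w).

Section CnfQuery.
Hypothesis T_gt1 : 1 < #|T|.
Variables (E : pred T) (occ : occ_spec).

Definition cnf_spec : rel_spec tau (RelFamily nf_arity) T W :=
  fun r => match r return
      ({ffun 'I_(nf_arity r) -> T} -> triple ('I_(nf_arity r) * W)) with
  | SymE => fun f => bool_triple _ (E (f ord0))
  | SymPos => fun f =>
      occ_triple (side ord0) (side ord_max) occ true (f ord0) (f ord_max)
  | SymNeg => fun f =>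
      occ_triple (side ord0) (side ord_max) occ false (f ord0) (f ord_max)
  end.

Lemma cnf_spec_valid : valid_spec cnf_spec.
Proof.
by case=> f; [exact: bool_triple_valid | exact: occ_triple_valid ..].
Qed.

Definition cnf_query : query tau sigma_cnf := tagged_query T_gt1 cnf_spec.

Lemma cnf_query_fop : is_fop cnf_query.
Proof. exact: tagged_query_fop cnf_spec_valid. Qed.

Variable A : structure tau.
Let h : T * {ffun W -> univ A} -> univ (apply_query cnf_query A) :=
  @query_elt _ _ _ _ T_gt1 cnf_spec A.

Lemma cnf_query_exist v : nf_exist (h v) = E v.1.
Proof.
rewrite /nf_exist; set t := [tuple _].
have -> : t = map_tuple h [tuple v] by apply: val_inj.
rewrite (@rel_of_query _ _ _ _ T_gt1 cnf_spec A SymE).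
by rewrite [LHS]eval_bool_triple ffunE.
Qed.

Lemma cnf_query_occ u v :
  nf_pos (h u) (h v) = occ_sem occ true u v /\
  nf_neg (h u) (h v) = occ_sem occ false u v.
Proof.
split; rewrite /nf_pos /nf_neg; set t := [tuple _; _];
  have -> : t = map_tuple h [tuple u; v] by apply: val_inj.
- rewrite (@rel_of_query _ _ _ _ T_gt1 cnf_spec A SymPos).
  rewrite [LHS](@eval_occ_triple _ _ _ _ _ _ u.2 v.2) // !ffunE.
  by case: u v {t} => ? ? [].
- rewrite (@rel_of_query _ _ _ _ T_gt1 cnf_spec A SymNeg).
  rewrite [LHS](@eval_occ_triple _ _ _ _ _ _ u.2 v.2) // !ffunE.
  by case: u v {t} => ? ? [].
Qed.

End CnfQuery.

Section GraphQuery.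
Variables (E : pred T) (occ : occ_spec).

(** Follows [gadj], with equality of vertices split into equality of tags, decided at once, and
    equality of tuples, the numeric formula [eqW]. *)
Definition gadget_triple V (x y : W -> V) (u v : gadget * T) : triple V :=
  let eqW := match_formula x y idp in
  match u.1, v.1 with
  | Lit s, Lit s' =>
      if (u.2 != v.2) || lit_link s s' then bool_triple V true
      else num_triple (Not eqW)
  | Lit s, Anchor s' | Anchor s', Lit s =>
      if (s == s') && (u.2 == v.2) then num_triple eqW else bool_triple V false
  | Lit s, Clause =>
      if s is Some b then nocc_triple y x occ b v.2 u.2 else bool_triple V true
  | Clause, Lit s =>
      if s is Some b then nocc_triple x y occ b u.2 v.2 else bool_triple V true
  | Anchor s, Anchor s' =>
      if [&& u.2 == v.2, E u.2 & anchor_link s s'] then num_triple eqW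
      else bool_triple V false
  | Anchor s, Hub => bool_triple V ((s == None) || ~~ E u.2)
  | Hub, Anchor s => bool_triple V ((s == None) || ~~ E v.2)
  | Clause, Hub | Hub, Clause => bool_triple V true
  | _, _ => bool_triple V false
  end.

Lemma gadget_triple_valid V (x y : W -> V) u v :
  triple_valid (gadget_triple x y u v).
Proof.
have nv phi : numeric phi -> @triple_valid V (num_triple phi).
  exact: num_triple_valid.
have n_eq : numeric (match_formula x y idp) by apply: numeric_match_formula.
case: u v => [[s|s||] t] [[s'|s'||] t']; rewrite /gadget_triple /=;
  repeat case: ifP => _; try exact: bool_triple_valid; try exact: nv.
  by case: s => [b|]; [apply: nocc_triple_valid | apply: bool_triple_valid].
by case: s' => [b|]; [apply: nocc_triple_valid | apply: bool_triple_valid].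
Qed.

Lemma eval_gadget_triple V (x y : W -> V) (A : structure tau) (e : V -> univ A)
    (ex ey : {ffun W -> univ A}) k t k' t' :
  e \o x =1 ex -> e \o y =1 ey ->
  triple_eval e (gadget_triple x y (k, t) (k', t')) =
  gadj (fun v => E v.1) (occ_sem occ (A := A)) (k, (t, ex)) (k', (t', ey)).
Proof.
move=> exE eyE; have eqE : eval e (match_formula x y idp) = (ex == ey).
  by rewrite (eval_match_formula _ exE eyE) pmatch_id.
rewrite /gadget_triple /gadj /=.
case: k k' => [s|s||] [s'|s'||]; rewrite ?eval_bool_triple ?xpair_eqE //.
- case: (t == t') (lit_link s s') => [] []; rewrite ?eval_bool_triple ?orbT //=.
  by rewrite eval_num_triple /= eqE orbF.
- by case: (s == s') (t == t') => [] []; rewrite ?eval_bool_triple ?eval_num_triple.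
- case: s => [b|]; rewrite ?eval_bool_triple //; exact: eval_nocc_triple.
- by case: (s' == s) (t == t') => [] []; rewrite ?eval_bool_triple ?eval_num_triple.
- case: (t == t') (E t) (anchor_link s s') => [] [] [];
  by rewrite ?andbT ?andbF ?eval_bool_triple ?eval_num_triple.
- case: s' => [b|]; rewrite ?eval_bool_triple //; exact: eval_nocc_triple.
Qed.

Definition graph_spec :
    rel_spec tau (RelFamily (fun _ : unit => 2)) (gadget * T)%type W :=
  fun _ f => gadget_triple (side ord0) (side ord_max) (f ord0) (f ord_max).

Lemma graph_spec_valid : valid_spec graph_spec.
Proof. by move=> r f; apply: gadget_triple_valid. Qed.

Hypothesis T_gt0 : 0 < #|T|.

Lemma gadget_tags_gt1 : 1 < #|{: gadget * T}|.
Proof.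
rewrite card_prod (leq_trans _ (leq_pmulr _ T_gt0)) //.
by apply/card_gt1P; exists Clause, Hub.
Qed.

Definition graph_query : query tau sigma_graph :=
  tagged_query gadget_tags_gt1 graph_spec.

Lemma graph_query_fop : is_fop graph_query.
Proof. exact: tagged_query_fop graph_spec_valid. Qed.

Lemma graph_query_2cc (A : structure tau) :
  abs_qunsat (fun v : T * {ffun W -> univ A} => E v.1)
             (occ_sem occ (A := A) true) (occ_sem occ (A := A) false) <->
  TwoCC (apply_query graph_query A).
Proof.
have [t0 _] := card_gt0P T_gt0.
apply: iff_trans (qunsat_2cc (t0, zeros A) _ _) _; apply: iff_sym.
(* The query tags tuples by pairs in [gadget * T], whereas [gadj] attaches a gadget to a tagged
   tuple; [h] regroups the components. *)
pose h (v : gadget * (T * {ffun W -> univ A})) : univ (apply_query graph_query A) :=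
  @query_elt _ _ _ _ gadget_tags_gt1 graph_spec A ((v.1, v.2.1), v.2.2).
apply: (@TwoCC_abs _ _ h).
  have [g hK gK] := @query_elt_bij _ _ _ _ gadget_tags_gt1 graph_spec A.
  exists (fun x => ((g x).1.1, ((g x).1.2, (g x).2))) => [[k [t e]]|x].
    by rewrite /h /= hK.
  by rewrite /h /= -[RHS]gK; case: (g x) => [[k t] e].
move=> [k [t e]] [k' [t' e']]; rewrite /adj /h /=; set ts := [tuple _; _].
have -> : ts = map_tuple (@query_elt _ _ _ _ gadget_tags_gt1 graph_spec A)
    [tuple ((k, t), e); ((k', t'), e')] by apply: val_inj.
apply: etrans (@rel_of_query _ _ _ _ gadget_tags_gt1 graph_spec A tt _) _.
by rewrite /graph_spec !ffunE; apply: eval_gadget_triple.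
Qed.

End GraphQuery.

Lemma cnf_query_abs (T_gt1 : 1 < #|T|) E occ (A : structure tau) :
  QUnsat2 (apply_query (cnf_query T_gt1 E occ) A) <->
  abs_qunsat (fun v : T * {ffun W -> univ A} => E v.1)
             (occ_sem occ (A := A) true) (occ_sem occ (A := A) false).
Proof.
apply: (QUnsat2_abs (query_elt_bij _ _ _)).
- exact: cnf_query_exist.
- by move=> u v; case: (cnf_query_occ T_gt1 E occ u v).
- by move=> u v; case: (cnf_query_occ T_gt1 E occ u v).
Qed.

(** Negating the sign in the query cancels the exchange of signs in [QSat2_abs]. *)
Lemma dnf_query_abs (T_gt1 : 1 < #|T|) E occ (A : structure tau) :
  @QSat2 (apply_query (cnf_query T_gt1 E (fun b => occ (~~ b))) A) <->
  abs_qunsat (fun v : T * {ffun W -> univ A} => E v.1)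
             (occ_sem occ (A := A) true) (occ_sem occ (A := A) false).
Proof.
apply: (QSat2_abs (query_elt_bij _ _ _)).
- exact: cnf_query_exist.
- by move=> u v; case: (cnf_query_occ T_gt1 E (fun b => occ (~~ b)) u v).
- by move=> u v; case: (cnf_query_occ T_gt1 E (fun b => occ (~~ b)) u v).
Qed.

End Occurrences.

Section ExistsUniqueQuery.
Variables (tau : vocabulary) (T W : finType).
Variables (t0 : T) (E : pred T) (occ : occ_spec tau T W).

Definition eu_tag_exist : pred (eu_role * T) := fun x =>
  match x.1 with
  | Variable_role => E x.2
  | Clause_role => true
  | Guard_role => false
  end.

(** The counterpart of [eu_occ] in patterns: the guard variable has the tag [t0] and the tuple of
    zeros. *)
Definition eu_tag_occ : occ_spec tau (eu_role * T)%type W := fun b x y =>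
  let triv := triv_lit tau W in
  let guard := if y.2 == t0 then Some (@zerop W, triv) else None in
  let same := if x.2 == y.2 then Some (@idp W, triv) else None in
  match x.1, y.1 with
  | Variable_role, Variable_role => if b || E x.2 then same else None
  | Variable_role, Guard_role => if b then None else guard
  | Clause_role, Variable_role => occ b x.2 y.2
  | Clause_role, Guard_role => if b then guard else None
  | Guard_role, Guard_role => if b then same else guard
  | _, _ => None
  end.

Lemma eu_tag_occE (A : structure tau) b r t e r' t' e' :
  occ_sem eu_tag_occ (A := A) b (r, t, e) (r', t', e') =
  eu_occ (t0, zeros W A) (fun v => E v.1) (occ_sem occ (A := A)) b
    (r, (t, e)) (r', (t', e')).
Proof.
have triv : zero_of A == zero_of A by [].
have same : (if t == t' then pmatch (@idp W) e e' && (zero_of A == zero_of A)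
             else false) = ((t, e) == (t', e')).
  by rewrite xpair_eqE triv pmatch_id andbT; case: eqP.
have guard : (if t' == t0 then pmatch (@zerop W) e e' && (zero_of A == zero_of A)
              else false) = ((t', e') == (t0, zeros W A)).
  by rewrite xpair_eqE triv pmatch_zero andbT; case: eqP.
rewrite /occ_sem /eu_tag_occ /eu_occ /= -guard -same.
case: r r' => [] [] //=; case: b => //=; try case: (E t) => //=;
  by case: eqP; rewrite ?andbT ?andbF ?eqb_id.
Qed.

Hypothesis T_gt0 : 0 < #|T|.

Lemma eu_tags_gt1 : 1 < #|{: eu_role * T}|.
Proof.
rewrite card_prod (leq_trans _ (leq_pmulr _ T_gt0)) //.
by apply/card_gt1P; exists Clause_role, Guard_role.
Qed.

Definition eu_query : query tau sigma_cnf :=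
  cnf_query eu_tags_gt1 eu_tag_exist eu_tag_occ.

Lemma eu_query_abs (A : structure tau) :
  ExistsUniqueSat (apply_query eu_query A) <->
  abs_qunsat (fun v : T * {ffun W -> univ A} => E v.1)
             (occ_sem occ (A := A) true) (occ_sem occ (A := A) false).
Proof.
apply: iff_sym; apply: iff_trans (qunsat_eusat (t0, zeros W A) _ _) _.
apply: iff_sym; pose q := @query_elt _ _ _ _ eu_tags_gt1
  (cnf_spec eu_tag_exist eu_tag_occ) A.
pose h (v : eu_role * (T * {ffun W -> univ A})) : univ (apply_query eu_query A) :=
  q ((v.1, v.2.1), v.2.2).
apply: (@ExistsUniqueSat_abs _ _ h).
- have [g hK gK] : bijective q by apply: query_elt_bij.
  exists (fun x => ((g x).1.1, ((g x).1.2, (g x).2))) => [[k [t e]]|x].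
    by rewrite /h /= hK.
  by rewrite /h /= -[RHS]gK; case: (g x) => [[k t] e].
- by move=> v; rewrite /h cnf_query_exist.
- move=> [r [t e]] [r' [t' e']]; rewrite -eu_tag_occE.
  by case: (cnf_query_occ eu_tags_gt1 eu_tag_exist eu_tag_occ (r, t, e) (r', t', e')).
- move=> [r [t e]] [r' [t' e']]; rewrite -eu_tag_occE.
  by case: (cnf_query_occ eu_tags_gt1 eu_tag_exist eu_tag_occ (r, t, e) (r', t', e')).
Qed.

End ExistsUniqueQuery.

(** * Tseitin clauses of a circuit *)

Section Circuits.
Variables (tau : vocabulary) (X : relfamily) (C : finType) (m : nat).
Let W : finType := (C + 'I_m.+1)%type.

(* [FNode w p q] reads "for some value of [w], not both [p] and [q]". *)
Inductive form :=
  | FLit of atom tau W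
  | FRel (r : X) of (arity r).-tuple (nterm W)
  | FNode of W & form & form.

Definition upd U (e : {ffun W -> U}) (w : W) (u : U) : {ffun W -> U} :=
  [ffun v => if v == w then u else e v].

Fixpoint evalf (A : structure tau) (I : interp X (univ A))
    (e : {ffun W -> univ A}) (f : form) : bool :=
  match f with
  | FLit a => aeval e a
  | FRel r ts => I r (map_tuple (neval e) ts)
  | FNode w p q =>
      [exists u, ~~ (evalf I (upd e w u) p && evalf I (upd e w u) q)]
  end.

(** Gates are positions in the tree, so equal subformulas at different places get different
    gates. *)
Fixpoint gate (f : form) : finType :=
  match f with
  | FNode _ p q => option (gate p + gate q)%type
  | _ => unit
  end.

Definition root_gate (f : form) : gate f :=
  match f return gate f with
  | FNode _ _ _ => None
  | _ => tt
  end.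

Fixpoint subf (f : form) : gate f -> form :=
  match f return gate f -> form with
  | FNode w p q => fun g =>
      match g with
      | None => FNode w p q
      | Some (inl g') => subf g'
      | Some (inr g') => subf g'
      end
  | f' => fun=> f'
  end.

Fixpoint child (b : bool) (f : form) : gate f -> gate f :=
  match f return gate f -> gate f with
  | FNode w p q => fun g =>
      match g with
      | None => if b then Some (inl (root_gate p)) else Some (inr (root_gate q))
      | Some (inl g') => Some (inl (child b g'))
      | Some (inr g') => Some (inr (child b g'))
      end
  | _ => id
  end.

Lemma subf_root f : subf (root_gate f) = f.
Proof. by case: f. Qed.

Lemma subf_child f (g : gate f) w p q b :
  subf g = FNode w p q -> subf (child b g) = if b then p else q.
Proof.
elim: f g b => // w' p' IHp q' IHq [[g|g]|] b /=; [exact: IHp | exact: IHq |].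
by case=> _ <- <-; case: b; rewrite /= subf_root.
Qed.

(** In the wide clauses of [circuit_occ] the test for the gate precedes the test for its children,
    so these must not coincide. *)
Lemma child_neq f (g : gate f) w p q b :
  subf g = FNode w p q -> child b g != g.
Proof.
elim: f g b => // w' p' IHp q' IHq [[g|g]|] b /=; last by case: b.
  by move/(IHp _ b); apply: contra => /eqP[->].
by move/(IHq _ b); apply: contra => /eqP[->].
Qed.

Definition local_spec (A : structure tau) (I : interp X (univ A)) f
    (v : gate f -> {ffun W -> univ A} -> bool) (g : gate f) : Prop :=
  forall e, v g e = match subf g with
    | FLit a => aeval e a
    | FRel r ts => I r (map_tuple (neval e) ts)
    | FNode w _ _ => [exists u, ~~ (v (child true g) (upd e w u) &&
                                   v (child false g) (upd e w u))]
    end.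

(** By induction on [f], the gate equations have only one solution, the evaluation. *)
Lemma local_spec_root A (I : interp X (univ A)) f v :
  (forall g : gate f, local_spec I v g) ->
  forall e, v (root_gate f) e = evalf I e f.
Proof.
elim: f v => [a|r ts|w p IHp q IHq] v Hv e; rewrite ?Hv //=.
have Hp := IHp (fun g => v (Some (inl g))) (fun g => Hv (Some (inl g))).
have Hq := IHq (fun g => v (Some (inr g))) (fun g => Hv (Some (inr g))).
by apply: eq_existsb => u; rewrite Hp Hq.
Qed.

Lemma evalf_local_spec A (I : interp X (univ A)) f (g : gate f) :
  local_spec I (fun g e => evalf I e (subf g)) g.
Proof.
move=> e; case def_g: (subf g) => [a|r ts|w p q] //=.
by apply: eq_existsb => u; rewrite !(subf_child _ def_g).
Qed.

Section CNF.
Variable f : form.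

Definition norm_pat (g : gate f) : pattern W := fun v =>
  if subf g is FNode w _ _ then Some (if v == w then NZero else NVar v)
  else Some (NVar v).

(** For a child [g] of a gate quantifying [w]: the coordinate [w] is free, unless [g] quantifies [w]
    again and its normal form has 0 there. *)
Definition wide_pat (g : gate f) (w : W) : pattern W := fun v =>
  if subf g is FNode w' _ _ then
    if v == w' then Some NZero else if v == w then None else Some (NVar v)
  else if v == w then None else Some (NVar v).

(** The arguments fill the first coordinates of ['I_m.+1] and all the rest is 0, so each tuple of a
    relation variable has one Boolean variable. *)
Definition rel_pat (ts : seq (nterm W)) : pattern W := fun v =>
  Some (if v is inr k then nth NZero ts k else NZero).

Section Patterns.
Variable A : structure tau.
Implicit Type e : {ffun W -> univ A}.

Definition norm (g : gate f) e : {ffun W -> univ A} :=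
  if subf g is FNode w _ _ then upd e w (zero_of A) else e.

Definition cell (t : seq (univ A)) : {ffun W -> univ A} :=
  [ffun v : C + 'I_m.+1 =>
     if v is inr k then nth (zero_of A) t k else zero_of A].

Lemma pmatch_norm g e e' : pmatch (norm_pat g) e e' = (e' == norm g e).
Proof.
rewrite eq_sym /norm /norm_pat; apply/forallP/eqP => [H|<- v].
  case: (subf g) H => [a|r ts|w p q] H; apply/ffunP => v;
    rewrite -(eqP (H v)) ?ffunE //.
  by case: ifP.
by case: (subf g) => [a|r ts|w p q]; rewrite ?ffunE //; case: ifP.
Qed.

Lemma pmatch_wide g w e e' :
  reflect (exists u, e' = norm g (upd e w u)) (pmatch (wide_pat g w) e e').
Proof.
rewrite /norm /wide_pat; apply: (iffP forallP) => [H|[u ->] v].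
  (* The free value is read off [e']; if [g] itself quantifies [w], normalization overwrites it
     anyway. *)
  exists (e' w); case: (subf g) H => [a|r ts|w' p q] H; apply/ffunP => v;
    move: (H v); rewrite !ffunE; do ?case: ifP => //.
  - by move/eqP-> => _.
  - by move=> _ /eqP.
  - by move/eqP-> => _.
  - by move=> _ /eqP.
  - by move=> _ /eqP.
  - by move/eqP-> => _.
  - by move=> _ _ /eqP.
case: (subf g) => [a|r ts|w' p q]; rewrite !ffunE; do ?case: ifP => //;
  by rewrite /neval /=.
Qed.

Lemma pmatch_rel ts e e' :
  pmatch (rel_pat ts) e e' = (e' == cell [seq neval e t | t <- ts]).
Proof.
have cellE (v : C + 'I_m.+1) :
    neval e (if v is inr k then nth NZero ts k else NZero) =
               cell [seq neval e t | t <- ts] v.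
  rewrite ffunE; case: v => [c|k] //.
  case: (ltnP k (size ts)) => Hk; first by rewrite (nth_map NZero).
  by rewrite !nth_default ?size_map.
apply/forallP/eqP => [H|-> v]; last by rewrite /rel_pat cellE.
by apply/ffunP => v; rewrite -cellE; apply/esym/eqP/(H v).
Qed.

End Patterns.

Definition cnf_tag : finType :=
  ((gate f + X) + option (option bool * gate f))%type.

(* Clauses of the circuit [f], with a Boolean variable z_g(e) for each gate g,
   used only at the normal form of e, where the variable quantified by g is 0.
   Tags: [inr None] forces the root; [inr (Some (Some b, g))] and
   [inr (Some (None, g))] define z_g, the former by clauses of two literals, or
   by a unit clause when g is an atom of the input; an element that is tagged as
   a variable indexes a tautology. *)
Definition circuit_occ : occ_spec tau cnf_tag W := fun b c v =>
  let triv := triv_lit tau W in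
  match c, v with
  | inl t, inl t' => if t == t' then Some (@idp W, triv) else None
  | inr None, inl (inl g) =>
      if b && (g == root_gate f) then Some (norm_pat g, triv) else None
  | inr (Some (k, g)), inl v =>
      match subf g with
      | FLit a => if v == inl g then Some (@idp W, (b, a)) else None
      | FRel r ts =>
          match v with
          | inl g' =>
              if (g' == g) && (b == isSome k) then Some (@idp W, triv) else None
          | inr r' =>
              if (r' == r) && (b != isSome k) then Some (rel_pat ts, triv)
              else None
          end
      | FNode w _ _ =>
          match v, k with
          | inl g', Some s =>
              if b && ((g' == g) || (g' == child s g))
              then Some (norm_pat g', triv) else None
          | inl g', None =>
              if b then None else
              if g' == g then Some (norm_pat g, triv) else
              if (g' == child true g) || (g' == child false g)
              then Some (wide_pat g' w, triv) else None
          | inr _, _ => None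
          end
      end
  | _, _ => None
  end.

Section Correctness.
Variables (A : structure tau) (I : interp X (univ A)).
Variable a : pred (cnf_tag * {ffun W -> univ A}).
Hypothesis aI : forall (r : X) (t : (arity r).-tuple (univ A)),
  a (inl (inr r), cell t) = I t.

Let occ := @occ_sem _ _ _ circuit_occ A.
Let z (g : gate f) e := a (inl (inl g), norm g e).

Lemma norm_upd (g : gate f) w p q (e : {ffun W -> univ A}) u :
  subf g = FNode w p q -> norm g (upd e w u) = norm g e.
Proof.
by rewrite /norm => ->; apply/ffunP => v; rewrite !ffunE; case: (v == w).
Qed.

Lemma upd_id U (e : {ffun W -> U}) w : upd e w (e w) = e.
Proof. by apply/ffunP => v; rewrite ffunE; case: eqP => // ->. Qed.

Lemma evalf_norm (g : gate f) (e : {ffun W -> univ A}) :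
  evalf I (norm g e) (subf g) = evalf I e (subf g).
Proof.
rewrite /norm; case: (subf g) => // w p q /=; apply: eq_existsb => u.
have -> : upd (upd e w (zero_of A)) w u = upd e w u.
  by apply/ffunP => v; rewrite !ffunE; case: (v == w).
by [].
Qed.

(** The clauses of each gate force its equation, so [z] is the evaluation of the subformulas, and
    the root clauses make [f] true everywhere. *)
Lemma sat_circuit : sat (occ true) (occ false) a ->
  forall e, evalf I e f.
Proof.
move=> /satP sa e.
have zP g : local_spec I z g.
  move=> {}e; case def_g: (subf g) => [at0|r ts|w p q].
  - have zE : z g e = a (inl (inl g), e) by rewrite /z /norm def_g.
    have [b [[[v|v] e']]] := sa (inr (Some (None, g)), e);
      rewrite /occ /occ_sem /circuit_occ /= ?def_g //.
    case: eqP => [->|//] /=; rewrite pmatch_id zE => /andP[/andP[/eqP-> /eqP->]].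
    by move/eqP.
  - have zE : z g e = a (inl (inl g), e) by rewrite /z /norm def_g.
    have xE : a (inl (inr r), cell [seq neval e t | t <- ts]) =
              I (map_tuple (neval e) ts) by rewrite -aI.
    rewrite -xE zE; apply/idP/idP.
      have [b [[[[g'|r']|v] e']]] := sa (inr (Some (None, g)), e);
        rewrite /occ /occ_sem /circuit_occ /= ?def_g //.
        case: ifP => // /andP[/eqP-> /eqP->]; rewrite pmatch_id andbT.
        by case/andP=> /eqP<- /eqP->.
      case: ifP => // /andP[/eqP-> ]; case: b => // _.
      by rewrite pmatch_rel andbT => /andP[/eqP-> /eqP->].
    have [b [[[[g'|r']|v] e']]] := sa (inr (Some (Some true, g)), e);
      rewrite /occ /occ_sem /circuit_occ /= ?def_g //.
      case: ifP => // /andP[/eqP-> /eqP->]; rewrite pmatch_id andbT.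
      by case/andP=> /eqP<- /eqP->.
    case: ifP => // /andP[/eqP-> ]; case: b => // _.
    by rewrite pmatch_rel andbT => /andP[/eqP-> /eqP->].
  (* If z_g is true, the wide clause yields a false child at some value of [w]; if z_g is false, the
     clauses of two literals make both children true at every value. *)
  - apply/idP/existsP => [zg|[u]].
      have [b [[[[g'|r']|v] e']]] := sa (inr (Some (None, g)), e);
        rewrite /occ /occ_sem /circuit_occ /= ?def_g //.
      case: b => //; case: (g' =P g) => [->|_] /=.
        rewrite pmatch_norm andbT => /andP[/eqP->].
        by rewrite -/(z g e) zg.
      case: ifP => // g'E; rewrite andbT => /andP[].
      move=> /(pmatch_wide g' w e e')[u ->]; rewrite -/(z g' _) => zg'.
      exists u; case/orP: g'E zg' => /eqP-> /eqP->; by rewrite ?andbF.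
    apply: contraR => nzg; apply/andP.
    suff Hs s : z (child s g) (upd e w u) by split.
    have [b [[[[g'|r']|v] e']]] := sa (inr (Some (Some s, g)), upd e w u);
      rewrite /occ /occ_sem /circuit_occ /= ?def_g //.
    case: b => //=; case: ifP => // g'E; rewrite pmatch_norm andbT.
    case/andP=> /eqP-> /eqP; rewrite -/(z g' _).
    case/orP: g'E => /eqP-> //.
    by rewrite /z (norm_upd _ _ def_g) -/(z g e) (negbTE nzg).
have [b [[[[g|r]|c] e']]] := sa (inr None, e);
  rewrite /occ /occ_sem /circuit_occ //=.
case: b => //=; case: eqP => [->|//]; rewrite pmatch_norm andbT.
by move=> /andP[/eqP-> /eqP Hr]; rewrite -(local_spec_root zP) /z.
Qed.

Lemma circuit_sat :
  (forall g e, a (inl (inl g), e) = evalf I e (subf g)) ->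
  (forall e, evalf I e f) -> sat (occ true) (occ false) a.
Proof.
move=> az Hf; apply/satP => -[[t|[[k g]|]] e].
- exists (a (inl t, e)), (inl t, e).
  by rewrite /occ /occ_sem /circuit_occ /= !eqxx /= pmatch_id !eqxx.
- case def_g: (subf g) => [at0|r ts|w p q].
  + exists (aeval e at0), (inl (inl g), e).
    rewrite /occ /occ_sem /circuit_occ /= def_g eqxx /= pmatch_id !eqxx /=.
    by rewrite az def_g.
  + have zE : a (inl (inl g), e) = I (map_tuple (neval e) ts) by rewrite az def_g.
    have xE : a (inl (inr r), cell [seq neval e t | t <- ts]) =
              I (map_tuple (neval e) ts) by rewrite -aI.
    have [kI|kI] := boolP (isSome k == I (map_tuple (neval e) ts)).
      exists (isSome k), (inl (inl g), e).
      by rewrite /occ /occ_sem /circuit_occ /= def_g !eqxx /= pmatch_id !eqxx zE eq_sym.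
    exists (~~ isSome k), (inl (inr r), cell [seq neval e t | t <- ts]).
    rewrite /occ /occ_sem /circuit_occ /= def_g !eqxx /= xE.
    have -> : (~~ isSome k != isSome k) by case: (isSome k).
    rewrite pmatch_rel !eqxx /=.
    by move: kI; case: (isSome k); case: (I _).
  + have gE e1 : evalf I e1 (subf g) = [exists u,
        ~~ (evalf I (upd e1 w u) (subf (child true g)) &&
            evalf I (upd e1 w u) (subf (child false g)))].
      by rewrite (evalf_local_spec I g e1) def_g.
    case: k => [s|].
      have [Hs|Hs] := boolP (evalf I e (subf (child s g))).
        exists true, (inl (inl (child s g)), norm (child s g) e).
        rewrite /occ /occ_sem /circuit_occ /= def_g !eqxx orbT /= pmatch_norm.
        by rewrite !eqxx az evalf_norm Hs.
      exists true, (inl (inl g), norm g e).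
      rewrite /occ /occ_sem /circuit_occ /= def_g !eqxx /= pmatch_norm !eqxx.
      (* The child [s] is false at [e] itself, that is, at the value [e w] of the quantified
         variable. *)
      rewrite az evalf_norm eqb_id gE; apply/existsP; exists (e w).
      rewrite upd_id negb_and; by case: s Hs => ->; rewrite ?orbT.
    have [Hg|Hg] := boolP (evalf I e (subf g)); last first.
      exists false, (inl (inl g), norm g e).
      rewrite /occ /occ_sem /circuit_occ /= def_g !eqxx /= pmatch_norm !eqxx.
      by rewrite az evalf_norm (negbTE Hg).
    move: Hg; rewrite gE => /existsP[u]; rewrite negb_and => Hu.
    have [s Hs] : exists s, ~~ evalf I (upd e w u) (subf (child s g)).
      by case/orP: Hu => Hu; [exists true | exists false].
    (* The wide clause contains the negated child at every value of [w], in particular at [u]. *)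
    exists false, (inl (inl (child s g)), norm (child s g) (upd e w u)).
    rewrite /occ /occ_sem /circuit_occ /= def_g (negbTE (child_neq s def_g)).
    have -> : (child s g == child true g) || (child s g == child false g).
      by case: s {Hs}; rewrite eqxx ?orbT.
    rewrite !eqxx andbT; apply/andP; split; first by apply/pmatch_wide; exists u.
    by rewrite az evalf_norm (negbTE Hs).
- exists true, (inl (inl (root_gate f)), norm (root_gate f) e).
  rewrite /occ /occ_sem /circuit_occ /= eqxx pmatch_norm !eqxx az evalf_norm.
  by rewrite subf_root Hf.
Qed.

End Correctness.
End CNF.
End Circuits.

(** * From second-order sentences to clauses *)

Section Translation.
Variables (tau : vocabulary) (X1 X2 : relfamily) (m : nat).
Let C := consym tau.
Let W : finType := (C + 'I_m.+1)%type.
Let X := sum_family X1 X2.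
Let sigma := expand_voc (expand_voc tau X1) X2.
Let wform := form tau X C m.

(* Bound variables are named by quantifier depth; [inr ord_max] is never one of
   them, and the constant [c] becomes the variable [inl c]. *)
Definition name (j : nat) : W := inr (inord j).
Definition dummy : W := inr ord_max.

Definition term_tr V (rho : V -> nat) (t : term sigma V) : nterm W :=
  match t with
  | Var v => NVar (name (rho v))
  | Con c => NVar (inl c : W)
  | Zero => NZero | One => NOne | Max => NMax
  end.

Definition atom_tr V (rho : V -> nat) (a : atom sigma V) : wform :=
  let tr t := term_of_nterm tau id (term_tr rho t) in
  match a with
  | Rel r ts =>
      match r as r0
        return ((@arity (rels sigma) r0).-tuple (term sigma V) -> wform) with
      | inl (inl r') => fun ts => FLit _ (@Rel tau W r' (map_tuple tr ts))
      | inl (inr r') => fun ts =>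
          @FRel tau X C m (inl r') (map_tuple (term_tr rho) ts)
      | inr r' => fun ts =>
          @FRel tau X C m (inr r') (map_tuple (term_tr rho) ts)
      end ts
  | Eq s t => FLit _ (Eq (tr s) (tr t))
  | Le s t => FLit _ (Le (tr s) (tr t))
  | Bit s t => FLit _ (Bit (tr s) (tr t))
  | Plus s t u => FLit _ (Plus (tr s) (tr t) (tr u))
  | Times s t u => FLit _ (Times (tr s) (tr t) (tr u))
  | Suc s t => FLit _ (Suc (tr s) (tr t))
  end.

(** Binding the dummy variable makes the quantifier of the node vacuous. *)
Definition FNand (p q : wform) : wform := FNode dummy p q.
Definition FNot (p : wform) : wform := FNand p p.

Definition push V (rho : V -> nat) (j : nat) (v : option V) : nat :=
  if v is Some v' then rho v' else j.

Fixpoint form_tr (V : Type) (rho : V -> nat) (j : nat)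
    (phi : formula sigma V) : wform :=
  match phi with
  | Atom a => atom_tr rho a
  | Not p => FNot (form_tr rho j p)
  | And p q => FNot (FNand (form_tr rho j p) (form_tr rho j q))
  | Or p q => FNand (FNot (form_tr rho j p)) (FNot (form_tr rho j q))
  | Ex p => let p' := FNot (form_tr (push rho j) j.+1 p) in FNode (name j) p' p'
  | All p => let p' := form_tr (push rho j) j.+1 p in FNot (FNode (name j) p' p')
  end.

Fixpoint qdepth (tau' : vocabulary) (V : Type) (phi : formula tau' V) : nat :=
  match phi with
  | Atom _ => 0
  | Not p => qdepth p
  | And p q | Or p q => maxn (qdepth p) (qdepth q)
  | Ex p | All p => (qdepth p).+1
  end.

Variable A : structure tau.
Variables (I1 : interp X1 (univ A)) (I2 : interp X2 (univ A)).

Definition sum_interp : interp X (univ A) :=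
  fun r => match r with inl r => @I1 r | inr r => @I2 r end.

(** Once constants are variables, an assignment may give them any values [k]; the translation is
    then compared with the structure where they denote [k]. *)
Definition set_con (k : C -> univ A) : structure tau :=
  @Structure tau (usize A) (usize_gt1 A) (@rel_of tau A) k.

Definition expand2 (k : C -> univ A) : structure sigma :=
  @expand _ (@expand _ (set_con k) X1 I1) X2 I2.

Let ev (e : {ffun W -> univ A}) (f : wform) := evalf sum_interp e f.

Definition constants (k : C -> univ A) (e : {ffun W -> univ A}) : Prop :=
  forall c, e (inl c) = k c.

Definition venv V (rho : V -> nat) (e : {ffun W -> univ A}) (v : V) : univ A :=
  e (name (rho v)).

Lemma eval_term_tr k V (rho : V -> nat) (e : {ffun W -> univ A}) t :
  constants k e ->
  neval e (term_tr rho t) = @teval sigma (expand2 k) V (venv rho e) t.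
Proof. by move=> ke; case: t => //= c; apply: ke. Qed.

Lemma eval_atom_tr k V (rho : V -> nat) (e : {ffun W -> univ A}) a :
  constants k e ->
  ev e (atom_tr rho a) = @aeval sigma (expand2 k) V (venv rho e) a.
Proof.
move=> ke; have trE t := @eval_term_tr k V rho e t ke.
case: a => [r ts|s t|s t|s t|s t u|s t u|s t] /=; rewrite -?trE //.
move: ts; case: r => [[r|r]|r] ts /=; rewrite ?/ev /=.
- by congr rel_of; apply: val_inj; rewrite /= -map_comp; apply: eq_map.
- by congr I1; apply: val_inj; rewrite /= -map_comp; apply: eq_map.
- by congr I2; apply: val_inj; rewrite /= -map_comp; apply: eq_map.
Qed.

Definition bounded V (rho : V -> nat) (j : nat) : Prop := forall v, rho v < j.

Lemma name_inj i j : i <= m -> j <= m -> name i = name j -> i = j.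
Proof. by move=> le_i le_j [] /(congr1 val) /=; rewrite !inordK. Qed.

Lemma name_dummy : dummy = name m.
Proof. by congr inr; apply: val_inj; rewrite /= inordK. Qed.

Lemma venv_upd V (rho : V -> nat) j i (e : {ffun W -> univ A}) u :
  bounded rho j -> j <= i <= m -> venv rho (upd e (name i) u) =1 venv rho e.
Proof.
move=> rho_lt /andP[le_ji le_im] v; rewrite /venv ffunE; case: eqP => // eq_n.
have lt_v := leq_trans (rho_lt v) le_ji.
have := name_inj (leq_trans (ltnW lt_v) le_im) le_im eq_n.
by move=> e_v; rewrite e_v ltnn in lt_v.
Qed.

Lemma venv_push V (rho : V -> nat) j (e : {ffun W -> univ A}) u :
  bounded rho j -> j <= m ->
  venv (push rho j) (upd e (name j) u) =1 scons u (venv rho e).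
Proof.
move=> rho_lt le_jm [v|] /=; last by rewrite /venv ffunE eqxx.
by rewrite -(venv_upd e u rho_lt (i := j)) ?leqnn.
Qed.

Lemma constants_upd k e j u : constants k e -> constants k (upd e (name j) u).
Proof. by move=> ke c; rewrite ffunE -ke. Qed.

Lemma eval_FNode e w p q :
  ev e (FNode w p q) = [exists u, ~~ (ev (upd e w u) p && ev (upd e w u) q)].
Proof. by []. Qed.

Section Connectives.
Variable P : {ffun W -> univ A} -> Prop.
Hypothesis P_upd : forall e u, P e -> P (upd e dummy u).

(** [P] holds the assignments at which the values of [p] and [q] are known; it must survive the
    update of the dummy variable made by the node. *)
Lemma eval_FNand b b' p q :
  (forall e, P e -> ev e p = b) -> (forall e, P e -> ev e q = b') ->
  forall e, P e -> ev e (FNand p q) = ~~ (b && b').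
Proof.
move=> Hp Hq e Pe; rewrite eval_FNode; apply/existsP/idP => [[u]|H].
  by rewrite Hp ?Hq //; apply: P_upd.
by exists (zero_of A); rewrite Hp ?Hq //; apply: P_upd.
Qed.

Lemma eval_FNot b p :
  (forall e, P e -> ev e p = b) -> forall e, P e -> ev e (FNot p) = ~~ b.
Proof. by move=> Hp e Pe; rewrite (eval_FNand Hp Hp) ?andbb. Qed.

End Connectives.

(** The bound on [j + qdepth phi] keeps the names of nested bound variables distinct from each other
    and from the dummy, which is [name m]. *)
Lemma eval_form_tr (k : C -> univ A) V (rho : V -> nat) j
    (phi : formula sigma V) (x : V -> univ A) :
  bounded rho j -> j + qdepth phi <= m ->
  forall e, constants k e /\ venv rho e =1 x ->
  ev e (form_tr rho j phi) = @eval sigma (expand2 k) V x phi.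
Proof.
have Pupd V' (rho' : V' -> nat) j' (x' : V' -> univ A) :
    bounded rho' j' -> j' <= m ->
    forall e u, constants k e /\ venv rho' e =1 x' ->
    constants k (upd e dummy u) /\ venv rho' (upd e dummy u) =1 x'.
  move=> rho_lt le_jm e u [ke xe]; rewrite name_dummy; split.
    exact: constants_upd.
  by move=> v; rewrite (venv_upd _ _ rho_lt) ?le_jm ?leqnn.
have step V' (rho' : V' -> nat) j' (x' : V' -> univ A) u :
    bounded rho' j' -> j' < m ->
    forall e, constants k e /\ venv rho' e =1 x' ->
    constants k (upd e (name j') u) /\
    venv (push rho' j') (upd e (name j') u) =1 scons u x'.
  move=> rho_lt lt_jm e [ke xe]; split; first exact: constants_upd.
  by move=> v; rewrite venv_push 1?ltnW //; apply: eq_scons.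
have bpush V' (rho' : V' -> nat) j' :
    bounded rho' j' -> bounded (push rho' j') j'.+1.
  by move=> rho_lt [v|] //=; rewrite ltnS ltnW.
elim: phi rho j x => {V} [V a|V p IH|V p IHp q IHq|V p IHp q IHq|V p IH|V p IH]
  rho j x rho_lt /= le_m.
- move=> e [ke xe]; rewrite (eval_atom_tr _ _ ke); exact: eq_aeval.
- have le_jm := leq_trans (leq_addr _ _) le_m.
  by apply: eval_FNot (Pupd _ _ _ _ rho_lt le_jm) _ _ _; apply: IH.
- have le_jm := leq_trans (leq_addr _ _) le_m.
  have [lp lq] : j + qdepth p <= m /\ j + qdepth q <= m.
    by move: le_m; rewrite addn_maxr geq_max => /andP.
  have P := Pupd _ _ _ x rho_lt le_jm.
  move=> e kxe; rewrite -[RHS]negbK; apply: (eval_FNot P _ kxe).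
  by apply: (eval_FNand P); [apply: IHp | apply: IHq].
- have le_jm := leq_trans (leq_addr _ _) le_m.
  have [lp lq] : j + qdepth p <= m /\ j + qdepth q <= m.
    by move: le_m; rewrite addn_maxr geq_max => /andP.
  have P := Pupd _ _ _ x rho_lt le_jm.
  move=> e kxe; rewrite -[RHS]negbK negb_or; apply: (eval_FNand P _ _ kxe).
    by apply: (eval_FNot P); apply: IHp.
  by apply: (eval_FNot P); apply: IHq.
- have lt_jm : j < m by apply: leq_trans le_m; rewrite addnS ltnS leq_addr.
  move=> e kxe; rewrite eval_FNode; apply: eq_existsb => u; rewrite andbb.
  rewrite (@eval_FNot _ (Pupd _ _ _ (scons u x) (bpush _ _ _ rho_lt) lt_jm)
    (@eval sigma (expand2 k) _ (scons u x) p)) ?negbK //.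
    by apply: IH; rewrite ?addSnnS //; apply: bpush.
  exact: step.
have lt_jm : j < m by apply: leq_trans le_m; rewrite addnS ltnS leq_addr.
have le_jm := ltnW lt_jm.
move=> e kxe; rewrite -[RHS]negbK.
apply: (eval_FNot (Pupd _ _ _ x rho_lt le_jm) _ kxe) => {kxe}e kxe.
rewrite negb_forall eval_FNode; apply: eq_existsb => u.
rewrite andbb; congr (~~ _).
apply: IH (step _ _ _ _ u rho_lt lt_jm _ kxe); rewrite ?addSnnS //.
exact: bpush.
Qed.

(* The negation of [phi], guarded so as to hold under every assignment that gives
   some constant a wrong value. *)
Definition sentence_form (phi : sentence sigma) : wform :=
  foldr (fun c f => FNand (FLit _ (Eq (Var _ (inl c : W)) (Con _ c))) (FNot f))
    (FNot (form_tr (of_void nat) 0 phi)) (enum C).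

Lemma eval_sentence_form (phi : sentence sigma) : qdepth phi <= m ->
  forall k e, constants k e ->
  ev e (sentence_form phi) =
  [exists c, k c != con_of A c] || ~~ models (expand2 k) phi.
Proof.
move=> le_m k e ke.
have Pupd e' u : constants k e' -> constants k (upd e' dummy u).
  by rewrite name_dummy; apply: constants_upd.
have -> : [exists c, k c != con_of A c] =
    has (fun c => k c != con_of A c) (enum C).
  by apply/existsP/hasP => [[c Hc]|[c _ Hc]]; exists c => //; rewrite mem_enum.
rewrite /sentence_form; elim: (enum C) e ke => [|c cs IH] /=.
  apply: (eval_FNot Pupd) => e ke; apply: eval_form_tr => //; split=> // -[].
move=> e ke; rewrite -orbA -[RHS]negbK negb_or negbK.
apply: (eval_FNand Pupd _ _ ke) => {ke}e ke; first by rewrite /ev /= ke.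
by apply: (eval_FNot Pupd _ ke).
Qed.

Lemma sentence_form_valid (phi : sentence sigma) : qdepth phi <= m ->
  (forall e, ev e (sentence_form phi)) <->
  ~~ models (@expand _ (expand I1) X2 I2) phi.
Proof.
move=> le_m; have expandE : expand2 (@con_of tau A) = @expand _ (expand I1) X2 I2.
  by rewrite /expand2 /set_con; case: (A) I1 I2.
rewrite -expandE; split=> [H|nphi e].
  (* At the assignment with the right constants no guard helps, so the negation of [phi] itself must
     hold. *)
  pose e : {ffun W -> univ A} := [ffun v : C + 'I_m.+1 =>
    if v is inl c then con_of A c else zero_of A].
  have := H e; rewrite (@eval_sentence_form _ le_m (@con_of tau A)).
    by case/orP=> // /existsP[c]; rewrite eqxx.
  by move=> c; rewrite ffunE.
have [/existsP ex|/existsPn no] := boolP [exists c, e (inl c) != con_of A c].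
  rewrite (@eval_sentence_form _ le_m (fun c => e (inl c))) //.
  by apply/orP; left; apply/existsP.
rewrite (@eval_sentence_form _ le_m (@con_of tau A)) ?nphi ?orbT //.
by move=> c; have := no c; rewrite negbK => /eqP.
Qed.

End Translation.

Lemma cellK m (C : finType) tau (A : structure tau) n (t : n.-tuple (univ A)) :
  n <= m.+1 -> [tuple cell C m t (inr (inord i)) | i < n] = t.
Proof.
move=> le_n; apply: eq_from_tnth => i.
rewrite tnth_mktuple ffunE inordK ?(leq_trans (ltn_ord i)) //.
by rewrite -tnth_nth.
Qed.

(** The common source of the four hardness proofs: tags, patterns and literals depend on the
    sentence alone, not on the input structure. *)
Lemma Sigma2p_cnf tau (B : structure tau -> Prop) : Sigma2p B ->
  exists (T W : finType) (E : pred T) (occ : occ_spec tau T W),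
    1 < #|T| /\ forall A : structure tau,
      B A <-> abs_qunsat (fun v : T * {ffun W -> univ A} => E v.1)
                (occ_sem occ (A := A) true) (occ_sem occ (A := A) false).
Proof.
case=> _ [X1 [X2 [phi Bphi]]].
pose X := sum_family X1 X2; pose C := consym tau.
(* The [m.+1] coordinates must hold the bound variables with the dummy, and also the arguments of
   any relation variable. *)
pose m := maxn (qdepth phi) (\max_(r : X) arity r).
pose f := sentence_form m phi.
pose T := cnf_tag f.
pose E (t : T) := if t is inl (inr (inl _)) then true else false.
exists T, (C + 'I_m.+1)%type, E, (circuit_occ (f := f)); split.
  by apply/card_gt1P; exists (inr None), (inl (inl (root_gate f))).
have le_qm : qdepth phi <= m by apply: leq_maxl.
have le_am (r : X) : arity r <= m.+1.
  rewrite leqW // (leq_trans _ (leq_maxr _ _)) //.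
  exact: (leq_bigmax (F := fun r : X => arity r)).
move=> A; apply: iff_trans (Bphi A) _.
pose read (e : {ffun C + 'I_m.+1 -> univ A}) n := [tuple e (inr (inord i)) | i < n].
split=> [[I1 HI1]|[s Hs]].
  exists (fun v => if v.1 is inl (inr (inl r)) then I1 r (read v.2 _) else false) => t.
  set a := mix _ _ _; apply/negP => sa.
  pose I2 : interp X2 (univ A) := fun r t' => t (inl (inr (inr r)), cell C m t').
  (* A satisfying assignment yields, through the cells, relations [I2] for which [phi] fails. *)
  have /negP[] : ~~ models (@expand _ (expand I1) X2 I2) phi; last exact: HI1.
  apply/(sentence_form_valid I1 I2 le_qm); apply: (sat_circuit _ sa).
  case=> r t' //; rewrite /a /mix /=.
  by rewrite [read _ _]cellK ?(le_am (inl r)).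
exists (fun r t' => s (inl (inr (inl r)), cell C m t')) => I2.
set I1 := fun r : X1 => _; apply/negPn/negP => nphi.
pose I := sum_interp I1 I2.
(* Gates get the values of their subformulas. The default [false] concerns variables that are
   existential or occur in no clause. *)
pose t (v : T * {ffun C + 'I_m.+1 -> univ A}) :=
  match v.1 with
  | inl (inl g) => evalf I v.2 (subf g)
  | inl (inr (inr r)) => I2 r (read v.2 _)
  | _ => false
  end.
have /negP[] := Hs t; apply: (circuit_sat (I := I)) => //.
  case=> r t' //=; rewrite /mix /t /=.
  by rewrite [read _ _]cellK ?(le_am (inr r)).
exact/(sentence_form_valid I1 I2 le_qm).
Qed.

(** * Defining sentences and completeness *)

Definition unary (K : finType) : relfamily := @RelFamily K (fun=> 1).

Section MonadicFormulas.
Variables (sigma : vocabulary) (K1 K2 : finType).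

Definition monadic_voc : vocabulary :=
  expand_voc (expand_voc sigma (unary K1)) (unary K2).

Definition MEx (k : K1) V (v : V) : formula monadic_voc V :=
  Atom (@Rel monadic_voc V (inl (inr k)) [tuple Var _ v]).
Definition MAll (k : K2) V (v : V) : formula monadic_voc V :=
  Atom (@Rel monadic_voc V (inr k) [tuple Var _ v]).
Definition Iff V (p q : formula monadic_voc V) : formula monadic_voc V :=
  Or (And p q) (And (Not p) (Not q)).
Definition Same V (u v : V) : formula monadic_voc V :=
  Atom (Eq (Var _ u) (Var _ v)).

Definition predicates (K : finType) U (I : interp (unary K) U) : K -> pred U :=
  fun k u => I k [tuple u].

Definition unary_interp (K : finType) U (s : K -> pred U) : interp (unary K) U :=
  fun k t => s k (tnth t ord0).

(** Assignments, colorings and vertex sets are unary relations, so all four membership proofs need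
    only monadic quantifiers. *)
Lemma so_models_monadic (A : structure sigma) (phi : sentence monadic_voc)
    (Q : (K1 -> pred (univ A)) -> (K2 -> pred (univ A)) -> Prop) :
  (forall I1 I2, models (@expand _ (@expand _ A (unary K1) I1) (unary K2) I2) phi
     <-> Q (predicates I1) (predicates I2)) ->
  so_models A phi <-> exists s, forall t, Q s t.
Proof.
move=> phiQ; split=> [[I1 H]|[s H]].
  by exists (predicates I1) => t; apply/(phiQ I1 (unary_interp t))/H.
by exists (unary_interp s) => I2; apply/phiQ/H.
Qed.

Variables (A : structure sigma).
Variables (I1 : interp (unary K1) (univ A)) (I2 : interp (unary K2) (univ A)).

Definition monadic : structure monadic_voc :=
  @expand _ (@expand _ A (unary K1) I1) (unary K2) I2.

Lemma eval_MEx V (e : V -> univ monadic) k v :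
  eval e (MEx k v) = predicates I1 k (e v).
Proof. by rewrite /=; congr (@I1 k); apply: val_inj. Qed.

Lemma eval_MAll V (e : V -> univ monadic) k v :
  eval e (MAll k v) = predicates I2 k (e v).
Proof. by rewrite /=; congr (@I2 k); apply: val_inj. Qed.

Lemma eval_Iff V (e : V -> univ monadic) p q :
  eval e (Iff p q) = (eval e p == eval e q).
Proof. by rewrite /=; case: (eval e p); case: (eval e q). Qed.

Lemma eval_Ex V (e : V -> univ monadic) p :
  eval e (Ex p) = [exists x, eval (scons x e) p].
Proof. by []. Qed.

Lemma eval_All V (e : V -> univ monadic) p :
  eval e (All p) = [forall x, eval (scons x e) p].
Proof. by []. Qed.

Lemma eval_Not V (e : V -> univ monadic) p : eval e (Not p) = ~~ eval e p.
Proof. by []. Qed.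

Lemma eval_And V (e : V -> univ monadic) p q :
  eval e (And p q) = eval e p && eval e q.
Proof. by []. Qed.

Lemma eval_Or V (e : V -> univ monadic) p q :
  eval e (Or p q) = eval e p || eval e q.
Proof. by []. Qed.

Lemma eval_Same V (e : V -> univ monadic) u v :
  eval e (Same u v) = (e u == e v).
Proof. by []. Qed.

End MonadicFormulas.

Arguments MEx {sigma K1 K2} k {V} v.
Arguments MAll {sigma K1 K2} k {V} v.
Arguments Same {sigma K1 K2 V} u v.

(** * Membership of the satisfiability problems *)

Section CnfMembership.
Variables K1 K2 : finType.
Let voc := monadic_voc sigma_cnf K1 K2.

Definition ExistF V (v : V) : formula voc V :=
  Atom (@Rel voc V (inl (inl SymE)) [tuple Var _ v]).
Definition PosF V (u v : V) : formula voc V :=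
  Atom (@Rel voc V (inl (inl SymPos)) [tuple Var _ u; Var _ v]).
Definition NegF V (u v : V) : formula voc V :=
  Atom (@Rel voc V (inl (inl SymNeg)) [tuple Var _ u; Var _ v]).

Definition MixF V (s t : V -> formula voc V) (v : V) : formula voc V :=
  Or (And (ExistF v) (s v)) (And (Not (ExistF v)) (t v)).

Definition SatF (swap : bool)
    (s t : option (option void) -> formula voc (option (option void))) :
    sentence voc :=
  let lit p n := let y := None in let x := Some None in
    Or (And (p x y) (MixF s t y)) (And (n x y) (Not (MixF s t y))) in
  All (Ex (if swap then lit (@NegF _) (@PosF _) else lit (@PosF _) (@NegF _))).

Variable A : structure sigma_cnf.
Variables (I1 : interp (unary K1) (univ A)) (I2 : interp (unary K2) (univ A)).
Let M := monadic I1 I2.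

Lemma eval_ExistF V (e : V -> univ M) v : eval e (ExistF v) = @nf_exist A (e v).
Proof. by rewrite /nf_exist /=; congr rel_of; apply: val_inj. Qed.

Lemma eval_PosF V (e : V -> univ M) u v : eval e (PosF u v) = @nf_pos A (e u) (e v).
Proof. by rewrite /nf_pos /=; congr rel_of; apply: val_inj. Qed.

Lemma eval_NegF V (e : V -> univ M) u v : eval e (NegF u v) = @nf_neg A (e u) (e v).
Proof. by rewrite /nf_neg /=; congr rel_of; apply: val_inj. Qed.

Lemma eval_SatF swap
    (s t : option (option void) -> formula voc (option (option void)))
    (ps pt : pred (univ A)) (e : void -> univ M) :
  (forall (e : _ -> univ M) v, eval e (s v) = ps (e v)) ->
  (forall (e : _ -> univ M) v, eval e (t v) = pt (e v)) ->
  eval e (SatF swap s t) =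
  if swap then sat (@nf_neg A) (@nf_pos A) (mix (@nf_exist A) ps pt)
  else sat (@nf_pos A) (@nf_neg A) (mix (@nf_exist A) ps pt).
Proof.
move=> Hs Ht; have mixE (e' : _ -> univ M) v : eval e' (MixF s t v) =
    mix (@nf_exist A) ps pt (e' v).
  rewrite /MixF eval_Or !eval_And eval_Not eval_ExistF Hs Ht /mix.
  by case: (nf_exist _); rewrite ?orbF.
rewrite /SatF; case: swap; rewrite eval_All; apply: eq_forallb => x;
  rewrite eval_Ex; apply: eq_existsb => y;
  by rewrite eval_Or !eval_And eval_Not mixE eval_PosF eval_NegF.
Qed.

End CnfMembership.

Lemma idb (U : Type) : bijective (@id U).
Proof. by exists id. Qed.

Lemma QSat2_Sigma2p : Sigma2p QSat2.
Proof.
split; first exact: decision_QSat2.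
pose phi : sentence (monadic_voc sigma_cnf unit unit) :=
  Not (SatF true (MEx tt) (MAll tt)).
exists (unary unit), (unary unit), phi => A.
pose Q (s t : unit -> pred (univ A)) : Prop :=
  ~~ sat (@nf_neg A) (@nf_pos A) (mix (@nf_exist A) (s tt) (t tt)).
apply: iff_trans (@QSat2_abs A _ id (idb _) _ _ _ _ _ _) _ => //.
apply: iff_sym; apply: iff_trans (@so_models_monadic sigma_cnf unit unit A phi Q _) _.
  move=> I1 I2; rewrite /models [eval _ _]eval_Not.
  rewrite (@eval_SatF _ _ A I1 I2 true _ _ (predicates I1 tt) (predicates I2 tt));
    [by [] | move=> e v; exact: (@eval_MEx _ _ _ A I1 I2 _ e _ v)
    | move=> e v; exact: (@eval_MAll _ _ _ A I1 I2 _ e _ v)].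
split=> [[s H]|[s H]]; [exists (s tt) => t | exists (fun=> s) => t]; last exact: H.
exact: (H (fun=> t)).
Qed.

Lemma QUnsat2_Sigma2p : Sigma2p QUnsat2.
Proof.
split; first exact: decision_QUnsat2.
pose phi : sentence (monadic_voc sigma_cnf unit unit) :=
  Not (SatF false (MEx tt) (MAll tt)).
exists (unary unit), (unary unit), phi => A.
pose Q (s t : unit -> pred (univ A)) : Prop :=
  ~~ sat (@nf_pos A) (@nf_neg A) (mix (@nf_exist A) (s tt) (t tt)).
apply: iff_trans (@QUnsat2_abs A _ id (idb _) _ _ _ _ _ _) _ => //.
apply: iff_sym; apply: iff_trans (@so_models_monadic sigma_cnf unit unit A phi Q _) _.
  move=> I1 I2; rewrite /models [eval _ _]eval_Not.
  rewrite (@eval_SatF _ _ A I1 I2 false _ _ (predicates I1 tt) (predicates I2 tt));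
    [by [] | move=> e v; exact: (@eval_MEx _ _ _ A I1 I2 _ e _ v)
    | move=> e v; exact: (@eval_MAll _ _ _ A I1 I2 _ e _ v)].
split=> [[s H]|[s H]]; [exists (s tt) => t | exists (fun=> s) => t]; last exact: H.
exact: (H (fun=> t)).
Qed.

(** The unique solution is guessed together with the existential assignment, as the relations
    [false] and [true] of the first block; the second block ranges over its rivals. *)
Lemma ExistsUniqueSat_Sigma2p : Sigma2p ExistsUniqueSat.
Proof.
split; first exact: decision_ExistsUniqueSat.
pose phi : sentence (monadic_voc sigma_cnf bool unit) :=
  And (SatF false (MEx true) (MEx false))
    (Or (Not (SatF false (MEx true) (MAll tt)))
      (All (Or (ExistF _ _ None) (Iff (MAll tt None) (MEx false None))))).
exists (unary bool), (unary unit), phi => A.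
pose Q (s : bool -> pred (univ A)) (t : unit -> pred (univ A)) : Prop :=
  let sat_with := fun t => sat (@nf_pos A) (@nf_neg A) (mix (@nf_exist A) (s true) t) in
  sat_with (s false) /\
  (sat_with (t tt) -> forall v, ~~ nf_exist v -> t tt v = s false v).
apply: iff_trans (@ExistsUniqueSat_abs A _ id (idb _) _ _ _ _ _ _) _ => //.
apply: iff_sym; apply: iff_trans (@so_models_monadic sigma_cnf bool unit A phi Q _) _.
  move=> I1 I2; rewrite /models [eval _ _]eval_And eval_Or eval_Not.
  rewrite (@eval_SatF _ _ A I1 I2 false _ _ (predicates I1 true) (predicates I1 false));
    [|move=> e v; exact: (@eval_MEx _ _ _ A I1 I2 _ e _ v)..].
  rewrite (@eval_SatF _ _ A I1 I2 false _ _ (predicates I1 true) (predicates I2 tt));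
    [| move=> e v; exact: (@eval_MEx _ _ _ A I1 I2 _ e _ v)
    | move=> e v; exact: (@eval_MAll _ _ _ A I1 I2 _ e _ v)].
  have -> : eval (@of_void (univ (monadic I1 I2)))
        (All (Or (ExistF _ _ None) (Iff (MAll tt None) (MEx false None))))
      = [forall v, @nf_exist A v || (predicates I2 tt v == predicates I1 false v)].
    rewrite eval_All; apply: eq_forallb => v.
    by rewrite eval_Or eval_ExistF eval_Iff eval_MAll eval_MEx.
  rewrite /Q -implybE; split=> [/andP[H1 /implyP H2]|[H1 H2]].
    split=> // /H2/forallP H v nEv; have := H v.
    by rewrite (negbTE nEv) => /eqP.
  apply/andP; split=> //; apply/implyP => /H2 H; apply/forallP => v.
  by case: (boolP (nf_exist v)) => //= nEv; apply/eqP/H.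
split=> [[s H]|[s [t [H1 H2]]]].
  exists (s true), (s false); split=> [|t]; first by case: (H (fun=> predT)).
  by case: (H (fun=> t)).
by exists (fun b => if b then s else t) => t'; split=> //; apply: H2.
Qed.

(** * Membership of clique coloring *)

Section GraphMembership.
Let voc := monadic_voc sigma_graph unit unit.

Definition AdjF V (u v : V) : formula voc V :=
  Atom (@Rel voc V (inl (inl tt)) [tuple Var _ u; Var _ v]).

Definition MaxCliqueF : sentence voc :=
  let y := None in let x := Some None in
  All (Or (And (MAll tt None)
               (All (Or (Not (MAll tt y)) (Or (Same x y) (AdjF x y)))))
          (And (Not (MAll tt None)) (Ex (And (MAll tt y) (Not (AdjF x y)))))).

Definition TwoCCF : sentence voc :=
  let y := None in let x := Some None in
  And (All (All (Iff (AdjF x y) (AdjF y x))))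
  (And (All (Not (AdjF None None)))
    (Or (Not MaxCliqueF)
      (Ex (Ex (And (MAll tt x) (And (MAll tt y) (Not (Iff (MEx tt x) (MEx tt y))))))))).

Variable G : structure sigma_graph.
Variables (I1 : interp (unary unit) (univ G)) (I2 : interp (unary unit) (univ G)).
Let M := monadic I1 I2.

Lemma eval_AdjF V (e : V -> univ M) u v : eval e (AdjF u v) = @adj G (e u) (e v).
Proof. by rewrite /adj /=; congr rel_of; apply: val_inj. Qed.

Lemma eval_MaxCliqueF (e : void -> univ M) :
  eval e MaxCliqueF = max_clique (@adj G) (predicates I2 tt).
Proof.
rewrite eval_All; apply: eq_forallb => x.
rewrite eval_Or !eval_And eval_Not eval_All eval_Ex eval_MAll.
have -> : [forall y, eval (scons y (scons x e))
      (Or (Not (MAll tt None)) (Or (Same (Some None) None) (AdjF (Some None) None)))]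
    = [forall y, predicates I2 tt y ==> (x != y) ==> @adj G x y].
  apply: eq_forallb => y.
  rewrite !eval_Or eval_Not eval_MAll eval_Same eval_AdjF.
  by rewrite !implybE negbK.
have -> : [exists y, eval (scons y (scons x e))
      (And (MAll tt None) (Not (AdjF (Some None) None)))]
    = [exists y, predicates I2 tt y && ~~ @adj G x y].
  by apply: eq_existsb => y; rewrite eval_And eval_Not eval_MAll eval_AdjF.
by rewrite /=; case: (predicates I2 tt x); rewrite ?orbF.
Qed.

Lemma eval_TwoCCF (e : void -> univ M) : eval e TwoCCF =
  [&& [forall x, forall y, @adj G x y == adj y x], [forall x, ~~ @adj G x x] &
      max_clique (@adj G) (predicates I2 tt) ==>
      [exists x, exists y, [&& predicates I2 tt x, predicates I2 tt y &
                               predicates I1 tt x != predicates I1 tt y]]].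
Proof.
rewrite !eval_And eval_Or eval_Not eval_MaxCliqueF !implybE.
congr [&& _, _ & _ || _].
- by rewrite eval_All; apply: eq_forallb => x; rewrite eval_All;
    apply: eq_forallb => y; rewrite eval_Iff !eval_AdjF.
- by rewrite eval_All; apply: eq_forallb => x; rewrite eval_Not eval_AdjF.
rewrite eval_Ex; apply: eq_existsb => x; rewrite eval_Ex; apply: eq_existsb => y.
by rewrite !eval_And eval_Not eval_Iff !eval_MAll !eval_MEx.
Qed.

End GraphMembership.

Lemma TwoCC_Sigma2p : Sigma2p TwoCC.
Proof.
split; first exact: decision_TwoCC.
exists (unary unit), (unary unit), TwoCCF => G.
pose Q (s t : unit -> pred (univ G)) : Prop :=
  [&& [forall x, forall y, @adj G x y == adj y x], [forall x, ~~ @adj G x x] &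
      max_clique (@adj G) (t tt) ==>
      [exists x, exists y, [&& t tt x, t tt y & s tt x != s tt y]]].
apply: iff_trans (@TwoCC_abs G _ id (idb _) (@adj G) _) _ => //.
apply: iff_sym; apply: iff_trans (@so_models_monadic sigma_graph unit unit G TwoCCF Q _) _.
  by move=> I1 I2; rewrite /models [eval _ _]eval_TwoCCF.
split=> [[s H]|[sG iG [c Hc]]].
  (* That the graph is simple does not depend on the vertex set, so any one will do. *)
  have /and3P[/forallP sG /forallP iG _] := H (fun=> predT).
  split=> [x y|x|]; first by have /forallP/(_ y)/eqP := sG x.
    exact/negbTE/iG.
  by exists (s tt) => K mK; have /and3P[_ _ /implyP] := H (fun=> K); apply.
exists (fun=> c) => t; apply/and3P; split.
- by apply/forallP => x; apply/forallP => y; rewrite sG.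
- by apply/forallP => x; rewrite iG.
- by apply/implyP/Hc.
Qed.

(** * Hardness of the four problems *)

Lemma QSat2_hard : Sigma2p_hard QSat2.
Proof.
move=> tau B /Sigma2p_cnf[T [W [E [occ [T_gt1 BE]]]]].
exists (cnf_query T_gt1 E (fun b => occ (~~ b))); first exact: cnf_query_fop.
by move=> A; apply: iff_trans (BE A) (iff_sym (dnf_query_abs _ _ _ _)).
Qed.

Lemma QUnsat2_hard : Sigma2p_hard QUnsat2.
Proof.
move=> tau B /Sigma2p_cnf[T [W [E [occ [T_gt1 BE]]]]].
exists (cnf_query T_gt1 E occ); first exact: cnf_query_fop.
by move=> A; apply: iff_trans (BE A) (iff_sym (cnf_query_abs _ _ _ _)).
Qed.

Lemma ExistsUniqueSat_hard : Sigma2p_hard ExistsUniqueSat.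
Proof.
move=> tau B /Sigma2p_cnf[T [W [E [occ [T_gt1 BE]]]]].
have [t0 _] := card_gt0P (ltnW T_gt1).
exists (eu_query t0 E occ (ltnW T_gt1)); first exact: cnf_query_fop.
by move=> A; apply: iff_trans (BE A) (iff_sym (eu_query_abs _ _ _ _ _)).
Qed.

Lemma TwoCC_hard : Sigma2p_hard TwoCC.
Proof.
move=> tau B /Sigma2p_cnf[T [W [E [occ [T_gt1 BE]]]]].
exists (graph_query E occ (ltnW T_gt1)); first exact: graph_query_fop.
by move=> A; apply: iff_trans (BE A) (graph_query_2cc _ _ _ _).
Qed.

Theorem theorem1 :
  [/\ Sigma2p_complete QSat2,
      Sigma2p_complete QUnsat2,
      Sigma2p_complete ExistsUniqueSat
    & Sigma2p_complete TwoCC].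
Proof.
split.
- exact: conj QSat2_Sigma2p QSat2_hard.
- exact: conj QUnsat2_Sigma2p QUnsat2_hard.
- exact: conj ExistsUniqueSat_Sigma2p ExistsUniqueSat_hard.
- exact: conj TwoCC_Sigma2p TwoCC_hard.
Qed.
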